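(* Let $N=2$, $Q=I_2$ and $B=\begin{pmatrix}-1&1\\-1&-1\end{pmatrix}$, and let $\mathcal L=\mathcal L^{Q,B}$ be the associated Ornstein--Uhlenbeck operator on $L^2(\gamma_\infty)$, where $\gamma_\infty$ is its invariant Gaussian probability measure. Then each generalized eigenfunction of $\mathcal L$ is an eigenfunction of $\mathcal L$. Moreover, any two eigenfunctions of $\mathcal L$ with different eigenvalues are orthogonal in $L^2(\gamma_\infty)$.
   Context: Let $Q$ be a real symmetric positive-definite $N\times N$ matrix and $B$ a real $N\times N$ matrix whose eigenvalues have negative real parts. For $t\in(0,+\infty]$ put $Q_t=\int_0^t e^{sB}Qe^{sB^*}\,ds$ (symmetric and positive definite) and let $\gamma_t$ be the Gaussian probability measure $d\gamma_t(x)=(2\pi)^{-N/2}(\det Q_t)^{-1/2}e^{-\frac12\langle Q_t^{-1}x,x\rangle}\,dx$ on $\mathbb R^N$. The Ornstein--Uhlenbeck semigroup is $\mathcal H_t f(x)=\int f(e^{tB}x-y)\,d\gamma_t(y)$, $t>0$, defined for bounded continuous $f$ and extended to $L^2(\gamma_\infty)$ (complex-valued functions); $\gamma_\infty$ is its unique invariant probability measure. The Ornstein--Uhlenbeck operator $\mathcal L=\mathcal L^{Q,B}$ is the infinitesimal generator of $(\mathcal H_t)_{t>0}$ on $L^2(\gamma_\infty)$; on Schwartz functions it is given by $\mathcal L f(x)=\frac12\operatorname{tr}(Q\nabla^2 f)(x)+\langle Bx,\nabla f(x)\rangle$, where $\nabla$ is the gradient and $\nabla^2$ the Hessian. A generalized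 eigenfunction of $\mathcal L$ with eigenvalue $\mu\in\mathbb C$ is a nonzero $u\in L^2(\gamma_\infty)$ (in the domain of the relevant power of $\mathcal L$) such that $(\mathcal L-\mu I)^k u=0$ for some positive integer $k$; it is an eigenfunction if $(\mathcal L-\mu I)u=0$. *)

(* Defs.v *)
From HB Require Import structures.
From mathcomp Require Import all_boot all_order all_algebra.
From mathcomp Require Import all_classical all_reals all_analysis.
From mathcomp Require Import measurable_realfun complex.

Set Implicit Arguments.
Unset Strict Implicit.
Unset Printing Implicit Defensive.

Import Order.TTheory GRing.Theory Num.Theory.
Import numFieldNormedType.Exports.
Import Normc.

Local Open Scope classical_set_scope.
Local Open Scope ring_scope.
Local Open Scope complex_scope.

(* The plane is the product space R * R, so that its topology, Borel
   sigma-algebra and Lebesgue measure are those of the library; [colv] and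
   [mxact] translate to and from column vectors.  [plane R] is convertible to
   R * R, but it carries the measurable structure on which the library defines
   the product of two copies of [lebesgue_measure]. *)
Notation plane R := (measurableTypeR R * measurableTypeR R)%type.

Section plane.
Context {R : realType}.
Implicit Types (A S : 'M[R]_2) (x y : R * R).

Definition lebesgue2 : {measure set (plane R) -> \bar R} :=
  ((@lebesgue_measure R) \x (@lebesgue_measure R))%E.

Definition colv x : 'cV[R]_2 := \col_i (if i == 0 then x.1 else x.2).

Definition mxact A x : R * R := ((A *m colv x) 0 0, (A *m colv x) 1 0).

Definition expmx A : 'M[R]_2 :=
  limn (series (fun k => (k`!)%:R^-1 *: A ^+ k)).

(* The factor [(2 * pi)^-1] is (2 pi)^(-N/2) for N = 2. *)
Definition gauss_pdf S x : R :=
  (2 * pi)^-1 * (Num.sqrt (\det S))^-1 *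
  expR (- (2^-1 * ((colv x)^T *m invmx S *m colv x) 0 0)).

Lemma gauss_pdf_ge0 S x : 0 <= gauss_pdf S x.
Proof.
by rewrite /gauss_pdf !mulr_ge0 ?invr_ge0 ?mulr_ge0 ?pi_ge0 ?sqrtr_ge0 ?expR_ge0.
Qed.

Lemma measurable_gauss_pdf S : measurable_fun setT (gauss_pdf S : plane R -> R).
Proof.
apply: measurable_funM => //; apply: measurableT_comp => //.
apply: measurableT_comp => //; apply: measurable_funM => //.
under eq_fun do rewrite mxE.
apply: measurable_sum => i; apply: measurable_funM.
  under eq_fun do rewrite mxE.
  apply: measurable_sum => j; apply: measurable_funM => //.
  under eq_fun do rewrite !mxE.
  by case: (j == 0); [exact: measurable_fst|exact: measurable_snd].
under eq_fun do rewrite !mxE.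
by case: (i == 0); [exact: measurable_fst|exact: measurable_snd].
Qed.

Definition gauss S (E : set (plane R)) : \bar R :=
  (\int[lebesgue2]_(x in E) (gauss_pdf S x)%:E)%E.

Let gauss0 S : gauss S set0 = 0%E.
Proof. by rewrite /gauss integral_set0. Qed.

Let gauss_ge0 S E : (0 <= gauss S E)%E.
Proof. by apply: integral_ge0 => x _; rewrite lee_fin gauss_pdf_ge0. Qed.

Let gauss_sigma_additive S : semi_sigma_additive (gauss S).
Proof.
move=> /= E mE tE mUE; rewrite /gauss ge0_integral_bigcup//; last 2 first.
- by apply: measurable_funTS; apply/measurable_EFinP; exact: measurable_gauss_pdf.
- by move=> x _; rewrite lee_fin gauss_pdf_ge0.
apply: is_cvg_ereal_nneg_natsum_cond => n _ _.
by apply: integral_ge0 => x _; rewrite lee_fin gauss_pdf_ge0.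
Qed.

HB.instance Definition _ S := isMeasure.Build _ _ _
  (gauss S) (gauss0 S) (@gauss_ge0 S) (@gauss_sigma_additive S).

End plane.

Section complex_functions.
Context {R : realType}.
Implicit Types (mu : {measure set (plane R) -> \bar R}) (f g : R * R -> R[i]).

Definition cintegral mu f : R[i] :=
  (\int[mu]_x complex.Re (f x)) +i* (\int[mu]_x complex.Im (f x)).

Definition L2norm mu f : \bar R := 'N[mu]_2%:E[(fun x => (normc (f x))%:E)]%E.

Definition inL2 mu f : Prop :=
  [/\ measurable_fun setT (fun x : plane R => complex.Re (f x)),
      measurable_fun setT (fun x : plane R => complex.Im (f x)) &
      (L2norm mu f < +oo)%E].

Definition L2inner mu f g : R[i] := cintegral mu (fun x => f x * (g x)^*).

Definition bounded_continuous f : Prop :=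
  [/\ continuous (fun x => complex.Re (f x)), continuous (fun x => complex.Im (f x)) &
      exists M : R, forall x, normc (f x) <= M].

End complex_functions.

Section ornstein_uhlenbeck.
Context {R : realType}.
Variables Q B : 'M[R]_2.
Implicit Types (f g u v : R * R -> R[i]) (mu : R[i]).

Definition OU_cov (t : \bar R) : 'M[R]_2 :=
  \matrix_(i, j) \int[lebesgue_measure]_(s in [set s | 0 <= s /\ (s%:E <= t)%E])
    (expmx (s *: B) *m Q *m (expmx (s *: B))^T) i j.

Definition OU_gauss (t : \bar R) : {measure set (plane R) -> \bar R} :=
  gauss (OU_cov t).

Definition OU_inv : {measure set (plane R) -> \bar R} := OU_gauss +oo%E.

Definition OU_sg (t : R) f (x : R * R) : R[i] :=
  cintegral (OU_gauss t%:E) (fun y => f (mxact (expmx (t *: B)) x - y)).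

(* [OU_sgL2 t f g]: the extension of [OU_sg t] by continuity from bounded
   continuous functions to L^2 maps the class of [f] to the class of [g]. *)
Definition OU_sgL2 (t : R) f g : Prop :=
  [/\ inL2 OU_inv f, inL2 OU_inv g &
   exists phi : nat -> R * R -> R[i],
   [/\ forall n, bounded_continuous (phi n),
       L2norm OU_inv (fun x => phi n x - f x) @[n --> \oo] --> 0%E &
       L2norm OU_inv (fun x => OU_sg t (phi n) x - g x) @[n --> \oo] --> 0%E]].

(* [OU_gen f g]: [f] is in the domain of the infinitesimal generator, which
   maps the class of [f] to the class of [g]. *)
Definition OU_gen f g : Prop :=
  [/\ inL2 OU_inv f, inL2 OU_inv g &
   exists h : R -> R * R -> R[i],
     (forall t, 0 < t -> OU_sgL2 t f (h t)) /\
     L2norm OU_inv (fun x => (t^-1)%:C * (h t x - f x) - g x) @[t --> 0^'+]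
       --> 0%E].

(* [OU_gen_pow mu k u w]: [u] is in the domain of the [k]-th power of the
   generator L, and (L - mu I)^k maps the class of [u] to the class of [w]. *)
Fixpoint OU_gen_pow mu (k : nat) u w : Prop :=
  match k with
  | 0 => inL2 OU_inv u /\ {ae OU_inv, forall x, u x = w x}
  | k'.+1 => exists v, OU_gen u v /\
                       OU_gen_pow mu k' (fun x => v x - mu * u x) w
  end.

Definition OU_generalized_eigenfunction mu u : Prop :=
  [/\ inL2 OU_inv u, ~ {ae OU_inv, forall x, u x = 0} &
      exists k, (0 < k)%N /\ OU_gen_pow mu k u (fun=> 0)].

Definition OU_eigenfunction mu u : Prop :=
  [/\ inL2 OU_inv u, ~ {ae OU_inv, forall x, u x = 0} &
      OU_gen_pow mu 1 u (fun=> 0)].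

End ornstein_uhlenbeck.

Definition B_rot (R : realType) : 'M[R]_2 :=
  \matrix_(i, j) (nth [::] [:: [:: -1; 1]; [:: -1; -1]] i)`_j.

(* Main.v *)
Require Import Defs.
From HB Require Import structures.
From mathcomp Require Import all_boot all_order all_algebra.
From mathcomp Require Import all_classical all_reals all_analysis.
From mathcomp Require Import measurable_realfun complex ring lra.

Set Implicit Arguments.
Unset Strict Implicit.
Unset Printing Implicit Defensive.

Import Order.TTheory GRing.Theory Num.Theory.
Import numFieldNormedType.Exports.
Import Normc.

Local Open Scope classical_set_scope.
Local Open Scope ring_scope.
Local Open Scope complex_scope.

(** The idea is that the Ornstein-Uhlenbeck semigroup of this pair (Q, B) is
a semigroup of normal operators, and that the theorem only needs the trace
which normality leaves on the generator, in the form of one inequality.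

Write B = - I + J, where J generates the rotations of the plane. Then e^(tB)
is the contraction e^(-t) times a rotation, so every covariance Q_t is a
multiple of the identity, and gamma_oo is the rotation invariant Gaussian
measure of covariance I / 2. The Mehler kernel of H_t is symmetric up to replacing
e^(tB) by its transpose [mehlerC], so that the adjoint of H_t is the same
Gaussian mean with e^(tB) transposed [gauss_mean_adjoint]. But the transpose
is e^(tB) composed with a rotation, and gamma_oo does not see rotations: H_t^*
phi is H_t phi composed with a rotation, whence |(H_t - c)^* phi| =
|(H_t - c) phi| for every complex number c [cgauss_mean_normal]. With the
Cauchy-Schwarz inequality this gives
  |<(H_t - c) phi, psi>| <= |phi| |(H_t - c) psi|
for bounded continuous phi and psi. The inequality is stable under L^2 limits,
hence holds for the extension of H_t to L^2 [OU_sgL2_weak_bound]; taking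
c = 1 + t mu, dividing by t and letting t tend to 0 it becomes
  |<(L - mu) u, w>| <= |u| |(L - mu) w|
for u and w in the domain of the generator L [OU_gen_weak_bound].

Both assertions are read off this inequality. If w = (L - mu) u is killed by
L - mu, then |w|^2 = |<(L - mu) u, w>| <= |u| |(L - mu) w| = 0, so a vector
killed by (L - mu)^(k+2) is killed by (L - mu)^(k+1) already
[OU_gen_pow_collapse]. If (L - mu) u = 0 and (L - nu) w = 0, the inequality
for nu says that <(L - nu) u, w> = (mu - nu) <u, w> vanishes
[OU_eigenfunction_orthogonal].

What remains is analysis in the plane. Rotation invariance of the Lebesgue
measure comes from writing a rotation as a product of three shears, each of
which preserves area by Fubini and the translation invariance of the measure
of the line. The entries of e^(tB) are power series solving a linear
differential system, from which the sum of their squares, e^(-2t), is found. *)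

(** * Borel sets of the plane and maps preserving area *)

Section plane_measurability.
Context {R : realType}.

(** The Borel sigma-algebra of the product is the product sigma-algebra because
the topology of the plane has a countable base, the rational rectangles. *)
Lemma open_measurable_plane (U : set (R * R)) :
  open U -> measurable (U : set (plane R)).
Proof.
move=> oU.
pose rect (q : (rat * rat) * (rat * rat)) : set (R * R) :=
  `]ratr q.1.1, ratr q.1.2[%classic `*` `]ratr q.2.1, ratr q.2.2[%classic.
pose F q : set (plane R) := if `[< rect q `<=` U >] then rect q else set0.
have -> : U = \bigcup_q F q.
  apply/seteqP; split=> [[x y] Uxy|z [q _]]; last first.
    by rewrite /F; case: asboolP => // qU /qU.
  have [[A B] /= [/nbhs_ballP[e /= e0 eA] /nbhs_ballP[d /= d0 dB]] ABU] :
    nbhs (x, y) U by exact: open_nbhs_nbhs.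
  have rat_near (z r : R) : 0 < r -> exists q : rat * rat,
      (z \in `]ratr q.1, ratr q.2[) /\
      `]ratr q.1, ratr q.2[%classic `<=` ball z r.
    move=> r0.
    have /rat_in_itvoo[q1 /itvP q1P] : z - r < z by rewrite ltrBlDr ltrDl.
    have /rat_in_itvoo[q2 /itvP q2P] : z < z + r by rewrite ltrDl.
    exists (q1, q2); split; first by rewrite in_itv/= q1P q2P.
    move=> w; rewrite /= in_itv/= => /andP[qw wq].
    rewrite /ball/= ltr_distlC.
    by rewrite (lt_trans _ qw) ?q1P// (lt_trans wq) ?q2P.
  have [q1 [xq1 q1x]] := rat_near x e e0.
  have [q2 [yq2 q2y]] := rat_near y d d0.
  exists (q1, q2) => //; rewrite /F asboolT; first by split.
  by move=> [a b] [/q1x/eA Aa /q2y/dB Bb]; exact: ABU.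
apply: countable_bigcupT_measurable; first exact: countableP.
by move=> q; rewrite /F; case: ifP => // _; exact: measurableX.
Qed.

Lemma continuous_measurable_plane (f : R * R -> R) :
  continuous f -> measurable_fun setT (f : plane R -> R).
Proof.
move=> /continuousP cf; apply: (measurability _ (RGenOpens.measurableE R)).
move=> _ [_ [a [b ->] <-]]; rewrite setTI; apply: open_measurable_plane.
exact/cf/interval_open.
Qed.

End plane_measurability.

Section plane_area.
Context {R : realType}.
Local Notation leb := (@lebesgue_measure R).
Local Notation leb2 := (leb \x leb)%E.

(** Translating a half-open interval does not change its length, and these
intervals determine the measure. *)
Lemma lebesgue_measure_translation (c : R) (A : set R) : measurable A ->
  leb [set y | A (y + c)] = leb A.
Proof.
pose phi : measurableTypeR R -> measurableTypeR R := fun y => y + c.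
have mphi : measurable_fun setT phi by exact: measurable_funD.
pose phiM : {mfun _ >-> _} := HB.pack phi (isMeasurableFun.Build _ _ _ _ _ mphi).
move=> mA; apply/esym.
apply: (lebesgue_measure_unique (mu := pushforward leb phiM)) => // _ [[a b]] _ <-.
rewrite /pushforward /= [X in _ = leb X](_ : _ = `]a - c, b - c]%classic); last first.
  by apply/seteqP; split=> y /=; rewrite !in_itv/= ltrBlDr lerBrDr.
rewrite !lebesgue_measure_itv/= !lte_fin ltrD2r -!EFinB.
by rewrite (_ : b - c - (a - c) = b - a)//; ring.
Qed.

Definition preserves_area (T : plane R -> plane R) :=
  measurable_fun setT T /\
  forall A, measurable A -> leb2 (T @^-1` A) = leb2 A.

Lemma preserves_area_comp (S T : plane R -> plane R) :
  preserves_area S -> preserves_area T -> preserves_area (S \o T).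
Proof.
move=> [mS SE] [mT TE]; split; first exact: measurableT_comp.
move=> A mA; rewrite comp_preimage TE ?SE//.
by rewrite -[X in measurable X]setTI; exact: mS.
Qed.

Lemma preserves_area_swap : preserves_area (fun x => (x.2, x.1)).
Proof.
pose swp : plane R -> plane R := fun x => (x.2, x.1).
have mS : measurable_fun setT swp by exact: measurable_swap.
pose S : {mfun _ >-> _} := HB.pack swp (isMeasurableFun.Build _ _ _ _ _ mS).
split=> // A mA; apply/esym.
apply: (product_measure_unique (m' := pushforward leb2 S)) => // B C mB mC.
transitivity (leb2 (C `*` B)); last by rewrite [LHS]product_measure1E// muleC.
by congr (leb2 _); apply/seteqP; split=> -[x y] [].
Qed.

(** A shear translates each vertical line along itself, so the claim follows
from translation invariance of the line after slicing. *)
Lemma preserves_area_shear (g : R -> R) : measurable_fun setT g ->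
  preserves_area (fun x => (x.1, x.2 + g x.1)).
Proof.
move=> mg; split.
  apply: measurable_fun_pair; first exact: measurable_fst.
  apply: measurable_funD; first exact: measurable_snd.
  by apply: measurableT_comp => //; exact: measurable_fst.
move=> A mA; apply: eq_integral => x _ /=.
rewrite -[RHS](@lebesgue_measure_translation (g x)); last exact: measurable_xsection.
by rewrite !xsectionE.
Qed.

Lemma preserves_area_shear2 (g : R -> R) : measurable_fun setT g ->
  preserves_area (fun x => (x.1 + g x.2, x.2)).
Proof.
move=> /preserves_area_shear h.
exact: preserves_area_comp preserves_area_swap
  (preserves_area_comp h preserves_area_swap).
Qed.

Lemma preserves_area_translation (v : R * R) :
  preserves_area (fun x => x + v).
Proof.
have h1 := preserves_area_shear (measurable_cst v.2).
have h2 := preserves_area_shear2 (measurable_cst v.1).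
exact: preserves_area_comp h1 h2.
Qed.

(** Multiplication by the complex number p - i q, with the plane as the complex
line; it is a rotation when p^2 + q^2 = 1. *)
Definition similarity (p q : R) (x : R * R) : R * R :=
  (p * x.1 + q * x.2, - q * x.1 + p * x.2).

Lemma similarity_comp p q r s x :
  similarity p q (similarity r s x) = similarity (p * r - q * s) (p * s + q * r) x.
Proof. by rewrite /similarity/=; congr pair; ring. Qed.

Lemma measurable_similarity p q :
  measurable_fun setT (similarity p q : plane R -> plane R).
Proof.
apply: measurable_fun_pair; apply: measurable_funD; apply: measurable_funM => //;
  by [exact: measurable_fst|exact: measurable_snd].
Qed.

(** Up to the degenerate half turn, a rotation is the product of a horizontal,
a vertical and a horizontal shear. *)
Lemma preserves_area_similarity p q : p ^+ 2 + q ^+ 2 = 1 -> preserves_area (similarity p q).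
Proof.
have mM (k : R) : measurable_fun setT (fun y : R => k * y).
  exact: measurable_funM.
have main a b : b != 0 -> a ^+ 2 + b ^+ 2 = 1 -> preserves_area (similarity a b).
  move=> b0 ab1.
  (* With a and b the cosine and the sine of an angle, this is the tangent of
     half the angle. *)
  pose k := (1 - a) / b.
  have h1 := preserves_area_shear2 (mM k).
  have h2 := preserves_area_shear (mM (- b)).
  have := preserves_area_comp h1 (preserves_area_comp h2 h1).
  have kb : k * b = 1 - a by rewrite /k divfK.
  have ka : k * (1 + a) = b.
    by rewrite /k mulrAC -subr_sqr expr1n -ab1 addrC addKr expr2 mulfK.
  congr preserves_area; apply/funext => x; rewrite /similarity/=.
  have -> : a = 1 - k * b by rewrite kb opprB addrC subrK.
  have eb : b = k * (2 - k * b) by rewrite kb -[LHS]ka; congr (_ * _); ring.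
  congr pair; last by ring.
  transitivity ((1 - k * b) * x.1 + k * (2 - k * b) * x.2); first by ring.
  by rewrite -eb.
have [-> p1|q0 pq1] := eqVneq q 0; last exact: main.
(* The half turn is the square of a quarter turn. *)
have h := main 0 1 (oner_neq0 _) ltac:(by rewrite expr0n add0r expr1n).
have /eqP : p ^+ 2 = 1 by rewrite -p1 expr0n addr0.
rewrite sqrf_eq1 => /orP[] /eqP->.
- split=> [|A mA]; first exact: measurable_similarity.
  by congr leb2; apply/seteqP; split=> -[x y];
    rewrite /similarity/= !mul1r !(oppr0, mul0r) addr0 add0r.
- have := preserves_area_comp h h; congr preserves_area.
  by apply/funext => x /=; rewrite similarity_comp; congr similarity; ring.
Qed.

(** The positive and the negative part are transported separately. *)
Lemma integral_preserves_area (T : plane R -> plane R) (f : plane R -> \bar R) :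
  preserves_area T -> measurable_fun setT f ->
  (\int[leb2]_x f (T x) = \int[leb2]_x f x)%E.
Proof.
move=> [mT TE] mf.
pose TM : {mfun _ >-> _} := HB.pack T (isMeasurableFun.Build _ _ _ _ _ mT).
have ge0E (g : plane R -> \bar R) : measurable_fun setT g -> (forall x, 0 <= g x)%E ->
    (\int[leb2]_x g (T x) = \int[leb2]_x g x)%E.
  move=> mg g0; transitivity (\int[pushforward leb2 TM]_x g x)%E.
    apply/esym; apply: (ge0_integral_pushforward mT leb2 measurableT mg).
    by move=> x _.
  by apply: eq_measure_integral => A mA _; exact: TE.
rewrite integralE [RHS]integralE; congr (_ - _)%E.
  rewrite [X in integral _ _ X](funepos_comp f T).
  by apply: ge0E; [exact: measurable_funepos|exact: funepos_ge0].
rewrite [X in integral _ _ X](funeneg_comp f T).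
by apply: ge0E; [exact: measurable_funeneg|exact: funeneg_ge0].
Qed.

(** Gives access to Fubini for integrals over two copies of the plane. *)
Lemma sigma_finite_lebesgue2 : sigma_finite [set: plane R] leb2.
Proof.
have /sigma_finiteP[F [TF ndF Foo]] := sigma_finiteT leb.
exists (fun n => F n `*` F n) => [|k].
  apply/seteqP; split=> // -[x y] _.
  have [[n _ Fnx] [k _ Fky]] : (\bigcup_i F i) x /\ (\bigcup_i F i) y by rewrite -TF.
  exists (maxn n k) => //; split.
    by move: x Fnx; exact/subsetPset/ndF/leq_maxl.
  by move: y Fky; exact/subsetPset/ndF/leq_maxr.
have [mF Fy] := Foo k; split; first exact: measurableX.
by rewrite product_measure1E// lte_mul_pinfty// ge0_fin_numE.
Qed.

(** The measure [lebesgue2] bundled with its sigma-finiteness. *)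
Definition area : {sigma_finite_measure set (plane R) -> \bar R} :=
  HB.pack leb2 (Measure_isSigmaFinite.Build _ (plane R) R leb2
   sigma_finite_lebesgue2).

End plane_area.

(** * Gaussian measures with scalar covariance *)

Section density.
Context d (T : measurableType d) (R : realType).
Variables (nu : {finite_measure set T -> \bar R})
  (mu : {sigma_finite_measure set T -> \bar R}) (h : T -> R).
Hypotheses (mh : measurable_fun setT h) (h0 : forall x, 0 <= h x).
Hypothesis nuE : forall A, measurable A -> nu A = (\int[mu]_(x in A) (h x)%:E)%E.
Local Open Scope ereal_scope.

Let ge0_integral_density (f : T -> \bar R) :
  measurable_fun setT f -> (forall x, 0 <= f x) ->
  \int[nu]_x f x = \int[mu]_x (f x * (h x)%:E).
Proof.
move=> mf f0.
have mhE : measurable_fun setT (EFin \o h) by exact/measurable_EFinP.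
have numu : nu `<< mu.
  apply/null_content_dominatesP => A mA muA0; rewrite nuE//.
  by apply: null_set_integral => //; exact: measurable_funTS.
rewrite -(Radon_Nikodym_SigmaFinite.change_of_variables numu)//.
have mRN := measurable_int _ (Radon_Nikodym_SigmaFinite.f_integrable numu).
apply: ae_eq_integral => //; [exact: emeasurable_funM..|].
apply: ae_eqe_mul2l.
apply: integral_ae_eq => //; first exact: Radon_Nikodym_SigmaFinite.f_integrable.
by move=> E _ mE; rewrite -Radon_Nikodym_SigmaFinite.f_integral// nuE.
Qed.

(** For nonnegative functions this is the change of variables of the
Radon-Nikodym theorem, since a density is almost everywhere the derivative;
the general case splits into positive and negative parts. *)
Lemma integral_density (f : T -> \bar R) : measurable_fun setT f ->
  \int[nu]_x f x = \int[mu]_x (f x * (h x)%:E).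
Proof.
move=> mf; rewrite integralE [RHS]integralE; congr (_ - _).
  rewrite ge0_integral_density//; last exact: measurable_funepos.
  by apply: eq_integral => x _; rewrite !funeposE maxe_pMl ?lee_fin// mul0e.
rewrite ge0_integral_density//; last exact: measurable_funeneg.
apply: eq_integral => x _.
by rewrite !funenegE maxe_pMl ?lee_fin// mul0e mulNe.
Qed.

End density.

Section gauss_scalar.
Context {R : realType}.
Local Notation leb := (@lebesgue_measure R).
Local Notation leb2 := (@area R).
Implicit Types (s p q : R) (x : R * R).

Definition sqnorm x : R := x.1 ^+ 2 + x.2 ^+ 2.

Lemma gauss_pdf_scalar s x : 0 < s ->
  gauss_pdf s%:M x = (2 * pi * s)^-1 * expR (- (sqnorm x / (2 * s))).
Proof.
move=> s0; rewrite /gauss_pdf det_scalar sqrtr_sqr gtr0_norm//.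
rewrite invmx_scalar mul_mx_scalar -scalemxAl mxE mxE.
rewrite (_ : \sum_(j < 2) _ = sqnorm x); last first.
  by rewrite !big_ord_recl big_ord0 !mxE/= addr0 -!expr2.
by rewrite !invfM; congr (_ * expR _); ring.
Qed.

Lemma gauss_pdf_gt0 s x : 0 < s -> 0 < gauss_pdf s%:M x.
Proof.
move=> s0; rewrite gauss_pdf_scalar// mulr_gt0 ?expR_gt0// invr_gt0.
by rewrite !mulr_gt0// pi_gt0.
Qed.

Lemma gauss_pdf_rotation s p q x : 0 < s -> p ^+ 2 + q ^+ 2 = 1 ->
  gauss_pdf s%:M (similarity p q x) = gauss_pdf s%:M x.
Proof.
move=> s0 pq1; rewrite !gauss_pdf_scalar//.
suff -> : sqnorm (similarity p q x) = sqnorm x by [].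
transitivity ((p ^+ 2 + q ^+ 2) * sqnorm x); last by rewrite pq1 mul1r.
by rewrite /sqnorm /similarity/=; ring.
Qed.

(** The density is a product of two normal densities of variance s. *)
Lemma gauss_scalar_setT s : 0 < s -> gauss s%:M [set: plane R] = 1%E.
Proof.
move=> s0; pose sd := Num.sqrt s.
have sd0 : sd != 0 by rewrite sqrtr_eq0 -ltNge.
have sd2 : sd ^+ 2 = s by rewrite sqr_sqrtr// ltW.
have mpdf : measurable_fun setT
    (fun z : plane R => (normal_pdf 0 sd z.1 * normal_pdf 0 sd z.2)%:E).
  apply/measurable_EFinP/measurable_funM;
    (apply: measurableT_comp; first exact: measurable_normal_pdf).
    exact: measurable_fst.
  exact: measurable_snd.
transitivity (\int[leb2]_z (normal_pdf 0 sd z.1 * normal_pdf 0 sd z.2)%:E)%E.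
  apply: eq_integral => x _; congr EFin; rewrite gauss_pdf_scalar// !normal_pdfE//.
  rewrite /normal_fun mulrACA -expRD /normal_peak !subr0 sd2; congr (_ * expR _).
    rewrite -invfM -expr2 sqr_sqrtr.
      by rewrite -[in RHS]mulr_natl [s * pi]mulrC mulrA.
    by rewrite mulrn_wge0// mulr_ge0 ?pi_ge0// ltW.
  by rewrite -mulrDl -opprD mulNr -[s *+ 2]mulr_natl.
rewrite (@fubini_tonelli1 _ _ _ _ _ leb leb)//=; last first.
  by move=> z; rewrite lee_fin mulr_ge0// normal_pdf_ge0.
rewrite -(@integral_normal_pdf R 0 sd); apply: eq_integral => x _.
transitivity (\int[leb]_y ((normal_pdf 0 sd x)%:E * (normal_pdf 0 sd y)%:E))%E => //.
rewrite ge0_integralZl// ?lee_fin ?normal_pdf_ge0//.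
- by rewrite integral_normal_pdf mule1.
- by apply/measurable_EFinP; exact: measurable_normal_pdf.
- by move=> y _; rewrite lee_fin normal_pdf_ge0.
Qed.

Lemma gauss_scalar_fin s : 0 < s -> fin_num_fun (gauss s%:M : set (plane R) -> \bar R).
Proof.
move=> s0; apply: lty_fin_num_fun.
by rewrite [X in (X < _)%E](gauss_scalar_setT s0) ltry.
Qed.

Lemma integral_gauss s (f : plane R -> \bar R) : 0 < s -> measurable_fun setT f ->
  (\int[gauss s%:M]_x f x = \int[leb2]_x (f x * (gauss_pdf s%:M x)%:E))%E.
Proof.
move=> s0 mf.
pose nu : {finite_measure set (plane R) -> \bar R} :=
  HB.pack (@gauss R s%:M) (Measure_isFinite.Build _ (plane R) R (@gauss R s%:M)
    (gauss_scalar_fin s0)).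
exact (@integral_density _ _ _ nu leb2 _ (@measurable_gauss_pdf R s%:M)
  (gauss_pdf_ge0 s%:M) (fun A mA => erefl) f mf).
Qed.

Lemma integral_gauss_rotation s p q (f : plane R -> \bar R) : 0 < s ->
  p ^+ 2 + q ^+ 2 = 1 -> measurable_fun setT f ->
  (\int[gauss s%:M]_x f (similarity p q x) = \int[gauss s%:M]_x f x)%E.
Proof.
move=> s0 pq1 mf; have mr := @measurable_similarity R p q.
rewrite !integral_gauss//; last exact: measurableT_comp.
rewrite -[RHS](integral_preserves_area (preserves_area_similarity pq1)).
  by apply: eq_integral => x _; rewrite gauss_pdf_rotation.
by apply: emeasurable_funM => //; apply/measurable_EFinP; exact: measurable_gauss_pdf.
Qed.

End gauss_scalar.

(** * The exponential of tB and the covariances *)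

Section matrix_exponential.
Context {R : realType}.
Implicit Types (t x : R) (k : nat).

(** The terms are dominated by those of the series of M * exp (2 |x|). *)
Lemma cvg_pseries_fact (a : nat -> R) (M x : R) :
  (forall k, `|a k| <= M * 2 ^+ k) -> cvgn (pseries (fun k => a k / k`!%:R) x).
Proof.
move=> aM; apply: normed_cvg.
apply: (@series_le_cvg _ _ (fun k => M * exp_coeff (2 * `|x|) k)) => [k|k|k|] /=.
- exact: normr_ge0.
- rewrite mulr_ge0 ?exp_coeff_ge0 ?mulr_ge0//.
  by have := aM 0%N; rewrite expr0 mulr1; exact: le_trans.
- rewrite !normrM normfV normr_nat normrX /exp_coeff/= exprMn.
  rewrite !mulrA [_ / _ * _]mulrAC ler_wpM2r ?invr_ge0// ler_wpM2r//.
- by apply: is_cvg_seriesZ; exact: is_cvg_series_exp_coeff.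
Qed.

(** Differentiating an exponential generating series shifts its coefficients. *)
Lemma is_derive_pseries_fact (a : nat -> R) (M x : R) :
  (forall k, `|a k| <= M * 2 ^+ k) ->
  is_derive x 1 (fun x => limn (pseries (fun k => a k / k`!%:R) x))
    (limn (pseries (fun k => a k.+1 / k`!%:R) x)).
Proof.
move=> aM.
have diffsE (b : nat -> R) : pseries_diffs (fun k => b k / k`!%:R) =
    (fun k => b k.+1 / k`!%:R).
  apply/funext => k; rewrite /pseries_diffs factS natrM invfM.
  by rewrite mulrCA mulVKf.
have aSM (b : nat -> R) (N : R) : (forall k, `|b k| <= N * 2 ^+ k) ->
    forall k, `|b k.+1| <= (N * 2) * 2 ^+ k.
  by move=> bN k; rewrite -mulrA -exprS; exact: bN.
have := @pseries_snd_diffs R (fun k => a k / k`!%:R) (`|x| + 1) x.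
rewrite !diffsE; apply.
- exact: cvg_pseries_fact aM.
- exact: cvg_pseries_fact (aSM _ _ aM).
- exact: cvg_pseries_fact (aSM _ _ (aSM _ _ aM)).
- by rewrite [ltRHS]ger0_norm ?addr_ge0// ltrDl.
Qed.

Lemma limn_pseries0 (c : nat -> R) : limn (pseries c 0) = c 0%N.
Proof.
apply: cvg_lim => //; apply: cvg_near_cst; exists 1%N => // -[//|n] _ /=.
rewrite /pseries /series/= big_nat_recl// expr0 mulr1 big1 ?addr0// => i _.
by rewrite expr0n mulr0.
Qed.

(** The coefficients of the powers of B on 1 and J = B + 1, where J^2 = - 1:
B^k = a_k + b_k J. These are the real and imaginary parts of (-1 + i)^k. *)
Fixpoint rot_coef k : R * R :=
  if k is k'.+1 then
    let: (a, b) := rot_coef k' in (- (a + b), a - b)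
  else (1, 0).

Let a k := (rot_coef k).1.
Let b k := (rot_coef k).2.

Let aS k : a k.+1 = - (a k + b k).
Proof. by rewrite /a /b/=; case: (rot_coef k). Qed.

Let bS k : b k.+1 = a k - b k.
Proof. by rewrite /a /b/=; case: (rot_coef k). Qed.

Let ab_le k : `|a k| <= 1 * 2 ^+ k /\ `|b k| <= 1 * 2 ^+ k.
Proof.
rewrite mul1r; elim: k => [|k [ak bk]]; first by rewrite /a /b/= normr1 normr0.
rewrite aS bS normrN exprS mulr_natl mulr2n; split.
  by rewrite (le_trans (ler_normD _ _))// lerD.
by rewrite (le_trans (ler_normB _ _))// lerD.
Qed.

Let a_le k := (ab_le k).1.
Let b_le k := (ab_le k).2.

(** [expC] and [expS] are e^(-t) cos t and e^(-t) sin t, in the form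
in which they occur in the exponential series of t B. *)
Definition expC t : R := limn (pseries (fun k => a k / k`!%:R) t).
Definition expS t : R := limn (pseries (fun k => b k / k`!%:R) t).

Lemma is_derive_expC t : is_derive t 1 expC (- (expC t + expS t)).
Proof.
have := @is_derive_pseries_fact _ _ t a_le; congr (is_derive _ _ _ _).
have -> : (fun k => a k.+1 / k`!%:R) =
    - ((fun k => a k / k`!%:R) + (fun k => b k / k`!%:R)).
  by apply/funext => k; rewrite aS !fctE mulNr mulrDl.
rewrite /pseries.
have -> : (fun i => (- ((fun k => a k / k`!%:R) + (fun k => b k / k`!%:R))) i * t ^+ i) =
    - ((fun i => a i / i`!%:R * t ^+ i) + (fun i => b i / i`!%:R * t ^+ i)).
  by apply/funext => k; rewrite !fctE mulNr mulrDl.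
have ca := @cvg_pseries_fact _ _ t a_le; have cb := @cvg_pseries_fact _ _ t b_le.
rewrite lim_seriesN; last first.
  exact: (is_cvg_seriesD ca cb).
by rewrite lim_seriesD.
Qed.

Lemma is_derive_expS t : is_derive t 1 expS (expC t - expS t).
Proof.
have := @is_derive_pseries_fact _ _ t b_le; congr (is_derive _ _ _ _).
rewrite /pseries.
have -> : (fun i => b i.+1 / i`!%:R * t ^+ i) =
    (fun i => a i / i`!%:R * t ^+ i) - (fun i => b i / i`!%:R * t ^+ i).
  by apply/funext => k; rewrite bS !fctE !mulrBl.
have ca := @cvg_pseries_fact _ _ t a_le; have cb := @cvg_pseries_fact _ _ t b_le.
by rewrite lim_seriesB.
Qed.

(** By the two differential equations, (C^2 + S^2) e^(2t) has derivative 0. *)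
Lemma expC2DexpS2 t : expC t ^+ 2 + expS t ^+ 2 = expR (- (2 * t)).
Proof.
pose f x := (expC x ^+ 2 + expS x ^+ 2) * expR (2 * x).
have df x : is_derive x 1 f 0.
  have dC := is_derive_expC x; have dS := is_derive_expS x.
  apply: is_derive_eq.
  rewrite /GRing.scale/=; ring.
have f0 : f 0 = 1.
  rewrite /f mulr0 expR0 /expC /expS !limn_pseries0 /a /b/= fact0.
  by rewrite divr1 mul0r expr1n expr0n addr0 mulr1.
have : f t = 1 by rewrite -f0; exact: is_derive_0_is_cst.
move=> /(congr1 (fun z => z * expR (- (2 * t)))).
by rewrite -mulrA -expRD subrr expR0 mulr1 mul1r.
Qed.

Lemma expmx_B_rot t :
  expmx (t *: B_rot R) = expC t *: 1 + expS t *: (B_rot R + 1).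
Proof.
have BBE (u v : R) : (u *: 1 + v *: (B_rot R + 1)) * B_rot R =
    - (u + v) *: 1 + (u - v) *: (B_rot R + 1).
  apply/matrixP => i j; rewrite !mxE !big_ord_recl big_ord0 !mxE/=.
  case: i => -[|[|//]] ?; case: j => -[|[|//]] ?; rewrite /=; ring.
have powE k : B_rot R ^+ k = a k *: 1 + b k *: (B_rot R + 1).
  elim: k => [|k IH]; first by rewrite /a /b/= scale1r scale0r addr0.
  by rewrite exprSr IH BBE aS bS.
have serE : series (fun k => k`!%:R^-1 *: (t *: B_rot R) ^+ k) =
    (fun n => pseries (fun k => a k / k`!%:R) t n *: 1 +
              pseries (fun k => b k / k`!%:R) t n *: (B_rot R + 1)).
  apply/funext => n; rewrite /pseries /series/= !scaler_suml -big_split/=.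
  apply: eq_bigr => k _; rewrite exprZn powE; move: (B_rot R + 1) => J.
  rewrite !scalerDr !scalerA.
  by congr (_ *: _ + _ *: _); ring.
have ca := @cvg_pseries_fact _ _ t a_le; have cb := @cvg_pseries_fact _ _ t b_le.
rewrite /expmx serE; apply: cvg_lim => //.
by apply: cvgD; apply: cvgZr_tmp.
Qed.

End matrix_exponential.

Section covariance.
Context {R : realType}.
Local Notation leb := (@lebesgue_measure R).
Implicit Types (t s : R) (x : R * R).

Lemma mxact_expmx t x :
  mxact (expmx (t *: B_rot R)) x = similarity (expC t) (expS t) x.
Proof.
rewrite expmx_B_rot /mxact /similarity !mxE !big_ord_recl !big_ord0 !mxE/=.
by congr pair; ring.
Qed.

(** The exponential is e^(-s) times an orthogonal matrix. *)
Lemma OU_cov_integrand s i j :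
  (expmx (s *: B_rot R) *m 1%:M *m (expmx (s *: B_rot R))^T) i j =
  expR (- 2 * s) * (i == j)%:R.
Proof.
rewrite mulNr -expC2DexpS2 expmx_B_rot mulmx1 !mxE !big_ord_recl !big_ord0 !mxE/=.
by case: i => -[|[|//]] ?; case: j => -[|[|//]] ?; rewrite /=; ring.
Qed.

(** The integrand e^(-2s) is half of the exponential density of rate 2, so the
covariances are masses of an exponential law. *)
Lemma OU_cov_scalar (t : \bar R) (D : set R) (v : R) : measurable D ->
  [set s : R | 0 <= s /\ (s%:E <= t)%E] = D ->
  (\int[leb]_(s in D) (exponential_pdf 2 s)%:E = (2 * v)%:E)%E ->
  OU_cov 1%:M (B_rot R) t = v%:M.
Proof.
move=> mD DE pdfv; apply/matrixP => i j; rewrite !mxE DE.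
under eq_Rintegral do rewrite OU_cov_integrand.
have [_|_] := eqVneq i j; last first.
  by rewrite /Rintegral; under eq_integral do rewrite mulr0; rewrite integral0.
rewrite mulr1n; apply: (mulfI (_ : 2 != 0)) => //.
have mE : measurable_fun D (fun s => (expR (- 2 * s))%:E).
  apply/measurable_EFinP; apply: measurable_funTS; apply: measurableT_comp => //.
have intE : (2%:E * \int[leb]_(s in D) (expR (- 2 * s))%:E =
    \int[leb]_(s in D) (exponential_pdf 2 s)%:E)%E.
  rewrite -ge0_integralZl//.
  apply: eq_integral => s; rewrite inE -DE => -[s0 _].
  by rewrite exponential_pdfE.
rewrite /Rintegral; under eq_integral do rewrite mulr1.
move: intE; rewrite pdfv; case: (integral _ _ _) => [r [<-]| |] //=.
  by rewrite mulry gtr0_sg// mul1e.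
by rewrite mulrNy gtr0_sg// mul1e.
Qed.

Lemma OU_cov_fin t : 0 < t ->
  OU_cov 1%:M (B_rot R) t%:E = ((1 - expR (- (2 * t))) / 2)%:M.
Proof.
move=> t0; apply: (@OU_cov_scalar _ `[0, t]%classic) => //.
  by apply/seteqP; split=> s /=; rewrite in_itv/= lee_fin => /andP.
rewrite -[LHS]/(exponential_prob 2 _) exponential_prob_itv0c//.
by rewrite mulNr [in RHS]mulrC divfK.
Qed.

Lemma OU_cov_infty : OU_cov 1%:M (B_rot R) +oo%E = (2^-1)%:M.
Proof.
apply: (@OU_cov_scalar _ `[0, +oo[%classic) => //.
  apply/seteqP; split=> s /=; rewrite in_itv/= andbT; first by case.
  by move=> s0; split=> //; exact: leey.
rewrite divff// -[RHS](@integral_exponential_pdf R 2)//.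
rewrite [LHS]integral_mkcond; apply: eq_integral => s _.
by rewrite patchE; case: ifPn => // sD; rewrite /exponential_pdf patchE (negbTE sD).
Qed.

End covariance.

(** * Complex square-integrable functions *)

Section complex_modulus.
Context {R : realType}.
Implicit Types (z w : R[i]).

Lemma sqr_normc z : normc z ^+ 2 = complex.Re z ^+ 2 + complex.Im z ^+ 2.
Proof. by case: z => a b; rewrite /= sqr_sqrtr ?addr_ge0 ?sqr_ge0. Qed.

Lemma normc_ge0 z : 0 <= normc z.
Proof. by case: z => a b; exact: sqrtr_ge0. Qed.

Lemma normc_conj z : normc z^*%R = normc z.
Proof. by case: z => a b; rewrite /= sqrrN. Qed.

Lemma normr_Re_le z : `|complex.Re z| <= normc z.
Proof.
by case: z => a b; rewrite /= -sqrtr_sqr ler_wsqrtr// lerDl sqr_ge0.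
Qed.

Lemma normr_Im_le z : `|complex.Im z| <= normc z.
Proof.
by case: z => a b; rewrite /= -sqrtr_sqr ler_wsqrtr// lerDr sqr_ge0.
Qed.

Lemma Re_mulconj z w :
  complex.Re (z * w^*) = complex.Re z * complex.Re w + complex.Im z * complex.Im w.
Proof. by case: z => a b; case: w => c d /=; ring. Qed.

Lemma Im_mulconj z w :
  complex.Im (z * w^*) = complex.Im z * complex.Re w - complex.Re z * complex.Im w.
Proof. by case: z => a b; case: w => c d /=; ring. Qed.

Lemma normr_sum_prod_le (a b c d : R) :
  `|a * c + b * d| <= (a ^+ 2 + b ^+ 2) + (c ^+ 2 + d ^+ 2).
Proof.
have := sqr_ge0 (a + c); have := sqr_ge0 (a - c).
have := sqr_ge0 (b + d); have := sqr_ge0 (b - d).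
have := sqr_ge0 a; have := sqr_ge0 b; have := sqr_ge0 c; have := sqr_ge0 d.
by rewrite ler_norml => *; apply/andP; split; nra.
Qed.

End complex_modulus.

Section complex_L2.
Context {R : realType}.
Variable mu : {measure set (plane R) -> \bar R}.
Implicit Types (f g h : R * R -> R[i]) (c : R[i]).

Definition cintegrable f :=
  mu.-integrable setT (fun x : plane R => (complex.Re (f x))%:E) /\
  mu.-integrable setT (fun x : plane R => (complex.Im (f x))%:E).

Lemma cintegralD f g : cintegrable f -> cintegrable g ->
  cintegral mu (f \+ g) = cintegral mu f + cintegral mu g.
Proof.
move=> [fr fi] [gr gi]; rewrite /cintegral.
under eq_Rintegral do rewrite /= raddfD.
under [X in _ +i* X = _]eq_Rintegral do rewrite /= raddfD.
by rewrite !RintegralD.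
Qed.

Lemma cintegralZ c f : cintegrable f ->
  cintegral mu (c \*o f) = c * cintegral mu f.
Proof.
case: c => a b [fr fi]; rewrite /cintegral.
have iZ (r : R) (u : plane R -> R) : mu.-integrable setT (EFin \o u) ->
    mu.-integrable setT (fun x => (r * u x)%:E).
  move=> iu; under eq_fun do rewrite EFinM.
  exact: integrableZl.
have -> : \int[mu]_x complex.Re ((a +i* b) * f x) =
    a * (\int[mu]_x complex.Re (f x)) - b * \int[mu]_x complex.Im (f x).
  rewrite -!RintegralZl// -RintegralB//; try exact: iZ.
  by apply: eq_Rintegral => x _; case: (f x).
have -> : \int[mu]_x complex.Im ((a +i* b) * f x) =
    a * (\int[mu]_x complex.Im (f x)) + b * \int[mu]_x complex.Re (f x).
  rewrite -!RintegralZl// -RintegralD//; try exact: iZ.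
  by apply: eq_Rintegral => x _; case: (f x).
by [].
Qed.

Lemma cintegral_conj f : cintegrable f ->
  cintegral mu (fun x => (f x)^*) = (cintegral mu f)^*.
Proof.
move=> [_ fi]; rewrite /cintegral /=; congr (_ +i* _).
  by apply: eq_Rintegral => x _; case: (f x).
rewrite -[RHS]mulN1r -RintegralZl//.
by apply: eq_Rintegral => x _; rewrite mulN1r; case: (f x).
Qed.

Definition sqmod f (x : plane R) : R := normc (f x) ^+ 2.

Lemma L2norm_sqmod f :
  L2norm mu f = poweR (\int[mu]_x (sqmod f x)%:E)%E 2^-1.
Proof.
rewrite /L2norm unlock; congr poweR; apply: eq_integral => x _ /=.
by rewrite powR_mulrn// real_normK// num_real.
Qed.

Lemma measurable_sqmod f :
  measurable_fun setT (fun x : plane R => complex.Re (f x)) ->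
  measurable_fun setT (fun x : plane R => complex.Im (f x)) ->
  measurable_fun setT (sqmod f).
Proof.
move=> mr mi; rewrite /sqmod; under eq_fun do rewrite sqr_normc.
by apply: measurable_funD; exact: measurable_funX.
Qed.

Lemma inL2P f : inL2 mu f <->
  [/\ measurable_fun setT (fun x : plane R => complex.Re (f x)),
      measurable_fun setT (fun x : plane R => complex.Im (f x)) &
      mu.-integrable setT (EFin \o sqmod f)].
Proof.
rewrite /inL2 L2norm_sqmod; split=> -[mr mi fin]; split=> //.
  apply/integrableP; split.
    by apply/measurable_EFinP; exact: measurable_sqmod.
  under eq_integral do rewrite /= ger0_norm ?sqr_ge0//.
  by apply: lty_poweRy fin; rewrite invr_eq0.
move/integrableP : fin => [_]; under eq_integral do rewrite /= ger0_norm ?sqr_ge0//.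
exact: poweR_lty.
Qed.

Lemma inL2D f g : inL2 mu f -> inL2 mu g -> inL2 mu (f \+ g).
Proof.
move=> /inL2P[fr fi ff] /inL2P[gr gi gg]; apply/inL2P.
have mr : measurable_fun setT (fun x : plane R => complex.Re ((f \+ g) x)).
  by under eq_fun do rewrite raddfD; exact: measurable_funD.
have mi : measurable_fun setT (fun x : plane R => complex.Im ((f \+ g) x)).
  by under eq_fun do rewrite raddfD; exact: measurable_funD.
split=> //.
apply: le_integrable (integrableD _ (integrableZl _ 2 ff) (integrableZl _ 2 gg)) => //.
  by apply/measurable_EFinP; exact: measurable_sqmod.
move=> x _ /=; rewrite lee_fin !ger0_norm ?addr_ge0 ?mulr_ge0 ?normc_ge0//.
rewrite /sqmod !sqr_normc !raddfD/=.
have := sqr_ge0 (complex.Re (f x) - complex.Re (g x)).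
have := sqr_ge0 (complex.Im (f x) - complex.Im (g x)).
move: (complex.Re (f x)) (complex.Im (f x)) (complex.Re (g x)) (complex.Im (g x)).
move=> a b c d; nra.
Qed.

Lemma inL2Z c f : inL2 mu f -> inL2 mu (c \*o f).
Proof.
move=> /inL2P[fr fi ff]; apply/inL2P; case: c => a b.
have mr : measurable_fun setT (fun x : plane R => complex.Re (((a +i* b) \*o f) x)).
  rewrite (_ : (fun _ => _) = (fun x => a * complex.Re (f x) - b * complex.Im (f x))).
    by apply: measurable_funB; exact: measurable_funM.
  by apply/funext => x /=; case: (f x).
have mi : measurable_fun setT (fun x : plane R => complex.Im (((a +i* b) \*o f) x)).
  rewrite (_ : (fun _ => _) = (fun x => a * complex.Im (f x) + b * complex.Re (f x))).
    by apply: measurable_funD; exact: measurable_funM.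
  by apply/funext => x /=; case: (f x).
split=> //; apply: le_integrable (integrableZl _ (normc (a +i* b) ^+ 2) ff) => //.
  by apply/measurable_EFinP; exact: measurable_sqmod.
by move=> x _; rewrite /= /sqmod normcM exprMn.
Qed.

Lemma inL2B f g : inL2 mu f -> inL2 mu g -> inL2 mu (f \- g).
Proof.
move=> f2 /(inL2Z (-1)) /(inL2D f2); congr inL2.
by apply/funext => x /=; rewrite mulN1r.
Qed.

(** Needed before any linearity of the inner product, since the integral of a
function that is not integrable is a default value. *)
Lemma cintegrable_mulconj f g : inL2 mu f -> inL2 mu g ->
  cintegrable (fun x => f x * (g x)^*).
Proof.
move=> /inL2P[fr fi ff] /inL2P[gr gi gg].
split; apply: le_integrable (integrableD _ ff gg) => //.
- apply/measurable_EFinP; under eq_fun do rewrite Re_mulconj.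
  by apply: measurable_funD; exact: measurable_funM.
- move=> x _ /=; rewrite lee_fin [leRHS]ger0_norm ?addr_ge0 ?sqr_ge0//.
  by rewrite Re_mulconj /sqmod !sqr_normc; exact: normr_sum_prod_le.
- apply/measurable_EFinP; under eq_fun do rewrite Im_mulconj.
  by apply: measurable_funB; exact: measurable_funM.
- move=> x _ /=; rewrite lee_fin [leRHS]ger0_norm ?addr_ge0 ?sqr_ge0//.
  rewrite Im_mulconj /sqmod !sqr_normc -mulNr.
  apply: le_trans (normr_sum_prod_le _ _ _ _) _.
  by rewrite sqrrN [X in X + _ <= _]addrC.
Qed.

Local Notation dot := (L2inner mu).

Lemma L2innerDl f g h : inL2 mu f -> inL2 mu g -> inL2 mu h ->
  dot (f \+ g) h = dot f h + dot g h.
Proof.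
move=> f2 g2 h2; rewrite /L2inner -cintegralD; [|exact: cintegrable_mulconj..].
by congr cintegral; apply/funext => x /=; rewrite mulrDl.
Qed.

Lemma L2innerZl c f h : inL2 mu f -> inL2 mu h -> dot (c \*o f) h = c * dot f h.
Proof.
move=> f2 h2; rewrite /L2inner -cintegralZ; last exact: cintegrable_mulconj.
by congr cintegral; apply/funext => x /=; rewrite mulrA.
Qed.

Lemma L2innerC f g : inL2 mu f -> inL2 mu g -> dot g f = (dot f g)^*.
Proof.
move=> f2 g2; rewrite /L2inner -cintegral_conj; last exact: cintegrable_mulconj.
by congr cintegral; apply/funext => x /=; rewrite rmorphM/= conjcK mulrC.
Qed.

Lemma L2innerBl f g h : inL2 mu f -> inL2 mu g -> inL2 mu h ->
  dot (f \- g) h = dot f h - dot g h.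
Proof.
move=> f2 g2 h2; rewrite -mulN1r -L2innerZl// -L2innerDl//; last exact: inL2Z.
by congr (L2inner mu _ h); apply/funext => x /=; rewrite mulN1r.
Qed.

Lemma L2innerBr f g h : inL2 mu f -> inL2 mu g -> inL2 mu h ->
  dot h (f \- g) = dot h f - dot h g.
Proof.
move=> f2 g2 h2; rewrite [LHS]L2innerC//; last exact: inL2B.
by rewrite L2innerBl// rmorphB/= [dot h f]L2innerC// [dot h g]L2innerC.
Qed.

Lemma L2innerZr c f h : inL2 mu f -> inL2 mu h -> dot h (c \*o f) = c^* * dot h f.
Proof.
move=> f2 h2; rewrite [LHS]L2innerC//; last exact: inL2Z.
by rewrite L2innerZl// rmorphM/= [dot h f]L2innerC.
Qed.

(** The L^2 norm as a real number; it is defined through the inner product to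
have the polarisation identities, see [L2norm_nrm] for the agreement with
the norm [L2norm]. *)
Definition nrm f : R := Num.sqrt (complex.Re (dot f f)).

Lemma Re_L2inner_self f : complex.Re (dot f f) = \int[mu]_x sqmod f x.
Proof.
rewrite /L2inner /cintegral /=; apply: eq_Rintegral => x _.
by rewrite Re_mulconj /sqmod sqr_normc !expr2.
Qed.

Lemma nrm_ge0 f : 0 <= nrm f. Proof. exact: sqrtr_ge0. Qed.

Lemma sqr_nrm f : nrm f ^+ 2 = complex.Re (dot f f).
Proof.
by rewrite sqr_sqrtr// Re_L2inner_self; apply: Rintegral_ge0 => x _; exact: sqr_ge0.
Qed.

Lemma L2inner_self f : inL2 mu f -> dot f f = (nrm f ^+ 2)%:C.
Proof.
move=> f2; rewrite sqr_nrm; have := L2innerC f2 f2.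
by case: (dot f f) => a b [] /= /eqP; rewrite -addr_eq0 -mulr2n mulrn_eq0/= => /eqP->.
Qed.

Lemma L2norm_nrm f : inL2 mu f -> L2norm mu f = (nrm f)%:E.
Proof.
move=> f2; have /inL2P[_ _ ff] := f2.
rewrite L2norm_sqmod /nrm Re_L2inner_self -powR12_sqrt; last first.
  by apply: Rintegral_ge0 => x _; exact: sqr_ge0.
rewrite -poweR_EFin; congr poweR; rewrite /Rintegral fineK//.
exact: integrable_fin_num.
Qed.

Lemma sqr_nrmB f g : inL2 mu f -> inL2 mu g ->
  nrm (f \- g) ^+ 2 = nrm f ^+ 2 - 2 * complex.Re (dot f g) + nrm g ^+ 2.
Proof.
move=> f2 g2; have fg2 := inL2B f2 g2.
rewrite sqr_nrm L2innerBl// !L2innerBr// [dot g f]L2innerC// !L2inner_self//.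
by case: (dot f g) => a b /=; ring.
Qed.

Lemma nrmZ c f : inL2 mu f -> nrm (c \*o f) = normc c * nrm f.
Proof.
move=> f2; apply/eqP; rewrite -(@eqrXn2 _ 2)// ?mulr_ge0 ?nrm_ge0 ?normc_ge0//.
rewrite sqr_nrm L2innerZl ?L2innerZr//; last exact: inL2Z.
by rewrite L2inner_self// exprMn sqr_normc; case: c => a b /=; apply/eqP; ring.
Qed.

(** The square norm of f - t d g is nonnegative for real t, where d is the
inner product of f and g. *)
Lemma cauchy_schwarz f g : inL2 mu f -> inL2 mu g ->
  normc (dot f g) <= nrm f * nrm g.
Proof.
move=> f2 g2; set d := dot f g.
(* The square norm of g may be 0; e makes the divisor positive. *)
suff H (e : R) : 0 < e -> normc d ^+ 2 <= nrm f ^+ 2 * (nrm g ^+ 2 + e).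
  rewrite -(@ler_pXn2r _ 2)// ?nnegrE ?mulr_ge0 ?nrm_ge0 ?normc_ge0// exprMn.
  have [f0|f0] := eqVneq (nrm f) 0.
    by have := H 1 ltr01; rewrite f0 expr0n/= !mul0r.
  have fp : 0 < nrm f ^+ 2 by rewrite exprn_gt0// lt_neqAle eq_sym f0 nrm_ge0.
  apply/ler_addgt0Pl => e e0.
  rewrite addrC (le_trans (H (e / nrm f ^+ 2) _)) ?divr_gt0//.
  by rewrite mulrDr [_ * (e / _)]mulrC divfK ?gt_eqF.
move=> e0; have g0 : 0 <= nrm g ^+ 2 by exact: sqr_ge0.
pose t := (nrm g ^+ 2 + e)^-1.
have t0 : 0 < t by rewrite invr_gt0 ltr_wpDl.
have := sqr_ge0 (nrm (f \- ((t%:C * d) \*o g))).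
rewrite sqr_nrmB//; last exact: inL2Z.
rewrite nrmZ// L2innerZr// -/d exprMn normcM exprMn.
have -> : complex.Re ((t%:C * d)^* * d) = t * normc d ^+ 2.
  by rewrite sqr_normc; case: d => a b /=; ring.
have -> : normc t%:C ^+ 2 = t ^+ 2 by rewrite sqr_normc /= expr0n addr0.
have tg : t * nrm g ^+ 2 <= 1 by rewrite /t ler_pdivrMl ?mulr1 ?lerDl ?ltW// ltr_wpDl.
rewrite -ler_pdivrMr ?ltr_wpDl// -/t.
have := sqr_ge0 (normc d); nra.
Qed.

Lemma nrmD f g : inL2 mu f -> inL2 mu g -> nrm (f \+ g) <= nrm f + nrm g.
Proof.
move=> f2 g2; rewrite -(@ler_pXn2r _ 2)// ?nnegrE ?addr_ge0 ?nrm_ge0//.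
have := cauchy_schwarz f2 (inL2Z (-1) g2); rewrite nrmZ//.
have -> : f \+ g = f \- ((-1) \*o g) by apply/funext => x /=; rewrite mulN1r opprK.
rewrite sqr_nrmB//; last exact: inL2Z.
rewrite nrmZ// normcN normc1 mul1r => dfg.
have := normr_Re_le (dot f ((-1) \*o g)); rewrite ler_norml => /andP[Re_ge _].
by rewrite sqrrD; nra.
Qed.

End complex_L2.

Section L2_null.
Context {R : realType}.
Variable mu : {measure set (plane R) -> \bar R}.
Implicit Types (f g : R * R -> R[i]) (c : R[i]).

(** A nonnegative function of integral 0 vanishes almost everywhere. *)
Lemma nrm_eq0P f : inL2 mu f ->
  nrm mu f = 0 <-> {ae mu, forall x, f x = 0}.
Proof.
move=> f2; have /inL2P[mr mi ff] := f2.
have msq : measurable_fun setT (EFin \o sqmod f).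
  by apply/measurable_EFinP; exact: measurable_sqmod.
have [sq0 sq0'] := ae_eq_integral_abs mu measurableT msq.
have intE : (\int[mu]_x `|(EFin \o sqmod f) x| = (nrm mu f ^+ 2)%:E)%E.
  rewrite sqr_nrm Re_L2inner_self /Rintegral fineK; last exact: integrable_fin_num.
  by apply: eq_integral => x _; rewrite gee0_abs// lee_fin sqr_ge0.
split=> [f0|f0].
  have : ae_eq mu setT (EFin \o sqmod f) (cst 0%E).
    by apply: sq0; rewrite intE f0 expr0n.
  apply: filterS => x /(_ I) [] /eqP.
  by rewrite /sqmod sqrf_eq0 => /eqP/eq0_normc.
apply/eqP; rewrite -sqrf_eq0 -eqe -intE; apply/eqP/sq0'.
have FF := @ae_filter_ringOfSetsType _ (plane R) R mu.
move: f0; apply: (@filterS _ _ FF) => x fx0 _.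
by rewrite /= /sqmod fx0 normc0 expr0n.
Qed.

Lemma nrmB_cvg {T} {F : set_system T} {FF : Filter F} (phi : T -> R * R -> R[i]) f :
  (\forall t \near F, inL2 mu (phi t)) -> inL2 mu f ->
  L2norm mu (fun x => phi t x - f x) @[t --> F] --> 0%E ->
  nrm mu (phi t \- f) @[t --> F] --> (0 : R).
Proof.
move=> phi2 f2 /fine_cvg; apply: cvg_trans; apply: near_eq_cvg.
near do rewrite /= -[X in fine (L2norm _ X)]/(_ \- _) L2norm_nrm//.
by near=> t; apply: inL2B => //; near: t.
Unshelve. all: by end_near. Qed.

(** The joint continuity of the inner product, with the error made explicit so
that it can be used along two sequences at once. *)
Lemma L2inner_perturb f g f' g' :
  inL2 mu f -> inL2 mu g -> inL2 mu f' -> inL2 mu g' ->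
  normc (L2inner mu f g) <= normc (L2inner mu f' g') +
    nrm mu (f' \- f) * nrm mu g + (nrm mu f + nrm mu (f' \- f)) * nrm mu (g' \- g).
Proof.
move=> f2 g2 f'2 g'2; have df2 := inL2B f'2 f2; have dg2 := inL2B g'2 g2.
have -> : L2inner mu f g =
    L2inner mu f' g' + - L2inner mu (f' \- f) g + - L2inner mu f' (g' \- g).
  by rewrite (L2innerBl f'2 f2 g2) (L2innerBr g'2 g2 f'2); ring.
apply: le_trans (le_normcD _ _) _; rewrite normcN; apply: lerD.
  apply: le_trans (le_normcD _ _) _; rewrite normcN lerD2l.
  exact: cauchy_schwarz.
apply: le_trans (cauchy_schwarz f'2 dg2) _; rewrite ler_wpM2r ?nrm_ge0//.
have := nrmD f2 df2; congr (nrm mu _ <= _).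
by apply/funext => x /=; rewrite addrC subrK.
Qed.

End L2_null.

(** * The Mehler kernel and the adjoint of a Gaussian mean *)

Section gaussian_mean.
Context {R : realType}.
Local Notation area := (@area R).
Implicit Types (s p q : R) (w x y z : R * R) (f g : R * R -> R).

Lemma subr_pairE x y : x - y = (x.1 - y.1, x.2 - y.2).
Proof. by case: x; case: y. Qed.

(** The reflection in the point w / 2; naming it lets it act on the plane with
its product measurable structure. *)
Definition point_reflection w : R * R -> R * R := fun y => w - y.

Lemma point_reflectionE w y : point_reflection w y = (w.1 - y.1, w.2 - y.2).
Proof. exact: subr_pairE. Qed.

(** A point reflection is a half turn followed by a translation. *)
Lemma integral_area_reflection w (f : plane R -> \bar R) :
  measurable_fun setT f ->
  (\int[area]_y f (point_reflection w y) = \int[area]_y f y)%E.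
Proof.
move=> mf.
have rot1 : (-1) ^+ 2 + 0 ^+ 2 = 1 :> R by rewrite sqrrN expr1n expr0n addr0.
have := preserves_area_comp (preserves_area_translation w) (preserves_area_similarity rot1).
move=> /integral_preserves_area-/(_ _ mf) <-; apply: eq_integral => y _.
congr f; rewrite point_reflectionE /similarity/= oppr0 !mul0r addr0 add0r !mulN1r.
by rewrite ![w.1 + _]addrC ![w.2 + _]addrC.
Qed.

Lemma measurable_point_reflection w :
  measurable_fun setT (point_reflection w : plane R -> plane R).
Proof.
rewrite (_ : point_reflection w = fun z => (w.1 - z.1, w.2 - z.2)); last first.
  by apply/funext => z; rewrite point_reflectionE.
apply: measurable_fun_pair; apply: measurable_funB => //;
  by [exact: measurable_fst|exact: measurable_snd].
Qed.

(** The convolution of f with a Gaussian as an integral against a kernel. *)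
Lemma integral_gauss_reflection s w (f : plane R -> \bar R) : 0 < s ->
  measurable_fun setT f ->
  (\int[gauss s%:M]_y f (point_reflection w y) =
   \int[area]_z (f z * (gauss_pdf s%:M (point_reflection w z))%:E))%E.
Proof.
move=> s0 mf; have mr := measurable_point_reflection w.
have mg : measurable_fun setT
    (fun z : plane R => (f z * (gauss_pdf s%:M (point_reflection w z))%:E)%E).
  apply: emeasurable_funM => //; apply/measurable_EFinP.
  by apply: measurableT_comp => //; exact: measurable_gauss_pdf.
apply: (etrans (integral_gauss s0 (measurableT_comp mf mr))).
apply: etrans (integral_area_reflection w mg).
by apply: eq_integral => y _; rewrite /= /point_reflection subKr.
Qed.

(** One step of the semigroup on real functions: [similarity p q] stands for
e^(tB) and s%:M for Q_t. *)
Definition gauss_mean s p q f x : R :=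
  \int[gauss s%:M]_y f (point_reflection (similarity p q x) y).

Definition bounded_measurable f :=
  measurable_fun setT (f : plane R -> R) /\ exists C, forall x, `|f x| <= C.

End gaussian_mean.

Section gauss_mean_adjoint.
Context {R : realType}.
Local Notation area := (@area R).
Variable s : R.
Hypothesis s0 : 0 < s.
Implicit Types (p q : R) (w x y z : R * R) (f g : R * R -> R).

Local Notation gs := (gauss_pdf s%:M).
Local Notation g12 := (gauss_pdf (2^-1)%:M).

Let half_gt0 : 0 < 2^-1 :> R. Proof. by rewrite invr_gt0. Qed.

(** The kernel of the Gaussian mean with respect to the Lebesgue measure,
weighted by the density of the invariant measure. *)
Definition mehler p q x z : R := gs (point_reflection (similarity p q x) z) * g12 x.

(** Both exponents equal (|x|^2 + |z|^2 - 2 <Ex, z>) / (2 s) with E the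
similarity (p, q), and changing the sign of q transposes E. The hypothesis on
s is what makes the Gaussian of covariance 1/2 invariant. *)
Lemma mehlerC p q x z : 2 * s = 1 - (p ^+ 2 + q ^+ 2) ->
  mehler p q x z = mehler p (- q) z x.
Proof.
move=> sE; rewrite /mehler !gauss_pdf_scalar// mulrACA [RHS]mulrACA -!expRD.
congr (_ * expR _).
rewrite divff// !divr1 -!opprD; congr (- _).
have s2 : 2 * s != 0 by rewrite mulf_neq0// gt_eqF.
apply: (mulIf s2); rewrite [LHS]mulrDl [RHS]mulrDl !divfK// sE.
by rewrite /sqnorm !point_reflectionE /similarity/=; ring.
Qed.

Lemma mehler_ge0 p q x z : 0 <= mehler p q x z.
Proof. by rewrite mulr_ge0// gauss_pdf_ge0. Qed.

Lemma measurable_mehler p q :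
  measurable_fun setT (fun u : plane R * plane R => mehler p q u.1 u.2).
Proof.
apply: measurable_funM; last first.
  by apply: measurableT_comp; [exact: measurable_gauss_pdf|exact: measurable_fst].
apply: measurableT_comp; first exact: measurable_gauss_pdf.
have m11 : measurable_fun setT (fun u : plane R * plane R => u.1.1).
  by apply: measurableT_comp; exact: measurable_fst.
have m12 : measurable_fun setT (fun u : plane R * plane R => u.1.2).
  by apply: measurableT_comp; [exact: measurable_snd|exact: measurable_fst].
have m21 : measurable_fun setT (fun u : plane R * plane R => u.2.1).
  by apply: measurableT_comp; [exact: measurable_fst|exact: measurable_snd].
have m22 : measurable_fun setT (fun u : plane R * plane R => u.2.2).
  by apply: measurableT_comp; exact: measurable_snd.
under eq_fun do rewrite point_reflectionE.
apply: measurable_fun_pair; apply: measurable_funB => //;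
  by apply: measurable_funD; exact: measurable_funM.
Qed.

Lemma integral_gs w : (\int[area]_z (gs (point_reflection w z))%:E = 1)%E.
Proof.
rewrite (integral_area_reflection w (f := EFin \o gs)).
  exact: gauss_scalar_setT s0.
by apply/measurable_EFinP; exact: measurable_gauss_pdf.
Qed.

Lemma measurable_gs w : measurable_fun setT (fun z : plane R => gs (point_reflection w z)).
Proof.
apply: measurableT_comp; first exact: measurable_gauss_pdf.
exact: measurable_point_reflection.
Qed.

Lemma integrable_gs w :
  area.-integrable setT (fun z : plane R => (gs (point_reflection w z))%:E).
Proof.
apply/integrableP; split; first by apply/measurable_EFinP; exact: measurable_gs.
under eq_integral do rewrite gee0_abs ?lee_fin ?gauss_pdf_ge0//.
by rewrite integral_gs ltry.
Qed.

(** Integrating z first leaves the invariant density, whose mass is 1. *)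
Lemma integrable_mehler p q :
  (area \x area)%E.-integrable setT
    (fun u : plane R * plane R => (mehler p q u.1 u.2)%:E).
Proof.
apply/integrable12ltyP.
  by apply/measurable_EFinP; exact: measurable_mehler.
have inner x : (\int[area]_z `|(mehler p q x z)%:E| = (g12 x)%:E)%E.
  transitivity (\int[area]_z ((gs (point_reflection (similarity p q x) z))%:E * (g12 x)%:E))%E.
    by apply: eq_integral => z _; rewrite gee0_abs ?lee_fin ?mehler_ge0.
  rewrite ge0_integralZr//=; first by rewrite integral_gs mul1e.
  - by apply/measurable_EFinP; exact: measurable_gs.
  - by move=> z _; rewrite lee_fin gauss_pdf_ge0.
  - by rewrite lee_fin gauss_pdf_ge0.
rewrite /=; under eq_integral do rewrite inner.
by have := gauss_scalar_setT half_gt0; rewrite /gauss => ->; rewrite ltry.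
Qed.

Lemma integrable_bounded_mehler p q f g :
  bounded_measurable f -> bounded_measurable g ->
  (area \x area)%E.-integrable setT
    (fun u : plane R * plane R => (f u.2 * g u.1 * mehler p q u.1 u.2)%:E).
Proof.
move=> [mf [C fC]] [mg [D gD]].
apply: le_integrable (integrableZl _ (C * D) (integrable_mehler p q)) => //.
  apply/measurable_EFinP; apply: measurable_funM; last exact: measurable_mehler.
  apply: measurable_funM; apply: measurableT_comp => //;
    by [exact: measurable_fst|exact: measurable_snd].
move=> u _ /=; rewrite lee_fin !normrM ler_wpM2r// ler_pM//.
- exact: le_trans (fC _) (ler_norm _).
- exact: le_trans (gD _) (ler_norm _).
Qed.

Lemma gauss_meanE p q f x : bounded_measurable f ->
  (gauss_mean s p q f x)%:E =
  (\int[area]_z (f z * gs (point_reflection (similarity p q x) z))%:E)%E /\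
  area.-integrable setT
    (fun z : plane R => (f z * gs (point_reflection (similarity p q x) z))%:E).
Proof.
move=> [mf [C fC]].
have int : area.-integrable setT
    (fun z : plane R => (f z * gs (point_reflection (similarity p q x) z))%:E).
  apply: le_integrable (integrableZl _ C (integrable_gs (similarity p q x))) => //.
    by apply/measurable_EFinP; apply: measurable_funM => //; exact: measurable_gs.
  move=> z _ /=; rewrite lee_fin !normrM ler_wpM2r//.
  exact: le_trans (fC _) (ler_norm _).
split=> //; rewrite /gauss_mean /Rintegral.
rewrite (integral_gauss_reflection _ s0 (f := EFin \o f)); last exact/measurable_EFinP.
under eq_integral do rewrite -EFinM.
by rewrite fineK//; exact: integrable_fin_num.
Qed.

(** Multiplying by the invariant density turns a mean, which is not integrable
over the plane in both variables, into an integral against [mehler]. *)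
Lemma gauss_mean_mul p q f x (c : R) : bounded_measurable f ->
  (gauss_mean s p q f x * c * g12 x)%:E =
  (\int[area]_z (f z * c * mehler p q x z)%:E)%E.
Proof.
move=> bf; have [fE fint] := gauss_meanE p q x bf.
rewrite -mulrA EFinM fE -integralZr//; apply: eq_integral => z _.
by rewrite -EFinM /mehler; congr EFin; ring.
Qed.

(** The mean is an average, hence keeps the bound of f. Measurability comes
from Fubini for the integrable kernel [mehler], whose weight is divided out
afterwards. *)
Lemma bounded_measurable_gauss_mean p q f :
  bounded_measurable f -> bounded_measurable (gauss_mean s p q f).
Proof.
move=> bf; have [mf [C fC]] := bf; split; last first.
  exists C => x; have [fE fint] := gauss_meanE p q x bf.
  have igs := integrable_gs (similarity p q x).
  have -> : gauss_mean s p q f x =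
      \int[area]_z (f z * gs (point_reflection (similarity p q x) z)).
    by rewrite /Rintegral -fE.
  apply: le_trans (le_normr_Rintegral measurableT fint) _.
  have <- : \int[area]_z (C * gs (point_reflection (similarity p q x) z)) = C.
    by rewrite RintegralZl// /Rintegral integral_gs mulr1.
  apply: le_Rintegral => //.
  - exact: integrable_norm.
  - exact: (integrableZl measurableT C igs).
  - by move=> z _; rewrite normrM [X in _ * X]ger0_norm ?gauss_pdf_ge0//
       ler_wpM2r ?gauss_pdf_ge0.
have b1 : bounded_measurable (fun=> 1 : R).
  by split=> //; exists 1 => x; rewrite normr1.
have := measurable_fubini_F (integrable_bounded_mehler p q bf b1).
rewrite /fubini_F /=; under eq_fun do rewrite -gauss_mean_mul// mulr1.
move=> /measurable_EFinP mT.
have -> : gauss_mean s p q f = fun x => gauss_mean s p q f x * g12 x * (g12 x)^-1.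
  by apply/funext => x; rewrite mulfK// gt_eqF// gauss_pdf_gt0.
apply: measurable_funM => //.
under eq_fun do rewrite gauss_pdf_scalar// invfM invrK expRN invrK.
apply: measurable_funM => //; apply: measurableT_comp => //.
apply: measurable_funM => //; apply: measurable_funD; apply: measurable_funX;
  by [exact: measurable_fst|exact: measurable_snd].
Qed.

Lemma integral_gauss_mean p q f g :
  bounded_measurable f -> bounded_measurable g ->
  (\int[gauss (2^-1)%:M]_x (gauss_mean s p q f x * g x)%:E =
   \int[area]_x \int[area]_z (f z * g x * mehler p q x z)%:E)%E.
Proof.
move=> bf bg; rewrite integral_gauss//.
  by apply: eq_integral => x _; rewrite -EFinM gauss_mean_mul.
apply/measurable_EFinP; apply: measurable_funM; last exact: bg.1.
exact: (bounded_measurable_gauss_mean _ _ bf).1.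
Qed.

(** Fubini, and the symmetry [mehlerC] of the kernel. *)
Lemma gauss_mean_adjoint p q f g : 2 * s = 1 - (p ^+ 2 + q ^+ 2) ->
  bounded_measurable f -> bounded_measurable g ->
  \int[gauss (2^-1)%:M]_x (gauss_mean s p q f x * g x) =
  \int[gauss (2^-1)%:M]_x (f x * gauss_mean s p (- q) g x).
Proof.
move=> sE bf bg; rewrite /Rintegral; congr fine.
apply: (etrans (integral_gauss_mean p q bf bg)).
apply: (etrans (Fubini (integrable_bounded_mehler p q bf bg))).
apply: etrans (eq_integral _ _ _); last first.
  by move=> x _; rewrite mulrC.
apply: etrans (esym (integral_gauss_mean p (- q) bg bf)).
by apply: eq_integral => x _; apply: eq_integral => z _; rewrite /= mehlerC// [f _ * _]mulrC.
Qed.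

End gauss_mean_adjoint.

(** * Normality of Gaussian means *)

Section normality.
Context {R : realType}.
Variables (s p q : R).
Hypotheses (s0 : 0 < s) (sE : 2 * s = 1 - (p ^+ 2 + q ^+ 2)).
Hypothesis pq0 : 0 < p ^+ 2 + q ^+ 2.
Implicit Types (f g : R * R -> R) (phi psi : R * R -> R[i]) (c : R[i]).

Local Notation gamma := (gauss (2^-1 : R)%:M).
Local Notation dot := (L2inner gamma).
Local Notation nrm := (nrm gamma).

Let half_gt0 : 0 < 2^-1 :> R. Proof. by rewrite invr_gt0. Qed.

Definition cgauss_mean s p q phi x : R[i] :=
  cintegral (gauss s%:M) (fun y => phi (similarity p q x - y)).

Definition cbounded_measurable phi :=
  bounded_measurable (fun x => complex.Re (phi x)) /\
  bounded_measurable (fun x => complex.Im (phi x)).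

Lemma cbounded_cgauss_mean (r : R) phi :
  cbounded_measurable phi -> cbounded_measurable (cgauss_mean s p r phi).
Proof. by move=> [br bi]; split;
  [exact: (@bounded_measurable_gauss_mean R s s0 p r _ br)
  |exact: (@bounded_measurable_gauss_mean R s s0 p r _ bi)]. Qed.

Lemma bounded_measurableM f g :
  bounded_measurable f -> bounded_measurable g ->
  bounded_measurable (fun x => f x * g x).
Proof.
move=> [mf [C fC]] [mg [D gD]]; split; first exact: measurable_funM.
by exists (C * D) => x; rewrite normrM ler_pM.
Qed.

Lemma bounded_integrable f : bounded_measurable f ->
  (gamma : {measure set (plane R) -> \bar R}).-integrable setT (EFin \o f).
Proof.
move=> [mf [C fC]]; apply/integrableP; split; first exact/measurable_EFinP.
apply: (@le_lt_trans _ _ (\int[gamma]_x (cst C%:E) x)%E).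
  apply: ge0_le_integral => //.
  - by apply: measurableT_comp => //; exact/measurable_EFinP.
  - by move=> x _; rewrite lee_fin.
by rewrite integral_cst// [X in (_ * X)%E](gauss_scalar_setT half_gt0) mule1 ltry.
Qed.

Lemma cbounded_inL2 phi : cbounded_measurable phi -> inL2 gamma phi.
Proof.
move=> [br bi]; apply/inL2P; split; [exact: br.1|exact: bi.1|].
rewrite (_ : sqmod phi = fun x => complex.Re (phi x) * complex.Re (phi x) +
    complex.Im (phi x) * complex.Im (phi x)).
  exact: (integrableD measurableT (bounded_integrable (bounded_measurableM br br))
  (bounded_integrable (bounded_measurableM bi bi))).
by apply/funext => x; rewrite /sqmod sqr_normc !expr2.
Qed.

(** The mean is a real operator, so the adjoint on complex functions is
obtained from the real and imaginary parts. *)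
Lemma cgauss_mean_adjoint phi psi :
  cbounded_measurable phi -> cbounded_measurable psi ->
  dot (cgauss_mean s p q phi) psi = dot phi (cgauss_mean s p (- q) psi).
Proof.
move=> bphi bpsi; have [fr fi] := bphi; have [gr gi] := bpsi.
have [Tfr Tfi] := cbounded_cgauss_mean q bphi.
have [Tgr Tgi] := cbounded_cgauss_mean (- q) bpsi.
have iM f g : bounded_measurable f -> bounded_measurable g ->
    (gamma : {measure set (plane R) -> \bar R}).-integrable setT
      (EFin \o (fun x => f x * g x)).
  by move=> bf bg; exact/bounded_integrable/bounded_measurableM.
rewrite /L2inner /cintegral.
under eq_Rintegral do rewrite Re_mulconj.
under [X in _ +i* X]eq_Rintegral do rewrite Im_mulconj.
under [in RHS]eq_Rintegral do rewrite Re_mulconj.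
under [in X in _ = _ +i* X]eq_Rintegral do rewrite Im_mulconj.
congr (_ +i* _).
  rewrite !RintegralD//; try exact: iM.
  by congr (_ + _); exact: gauss_mean_adjoint.
rewrite !RintegralB//; try exact: iM.
by congr (_ - _); exact: gauss_mean_adjoint.
Qed.

Lemma nrm_rotation (u v : R) phi : u ^+ 2 + v ^+ 2 = 1 -> inL2 gamma phi ->
  nrm (phi \o similarity u v) = nrm phi.
Proof.
move=> uv1 /inL2P[mr mi _]; congr Num.sqrt; rewrite !Re_L2inner_self /Rintegral.
rewrite -[in RHS](integral_gauss_rotation half_gt0 uv1)//.
by apply/measurable_EFinP; exact: measurable_sqmod.
Qed.

(** The transpose of the similarity (p, q) is the product of (p, q) with a
rotation, of twice the angle. *)
Lemma cgauss_mean_similarity phi :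
  cgauss_mean s p (- q) phi =
  cgauss_mean s p q phi \o
    similarity ((p ^+ 2 - q ^+ 2) / (p ^+ 2 + q ^+ 2)) (- (2 * p * q) / (p ^+ 2 + q ^+ 2)).
Proof.
apply/funext => x; rewrite /= /cgauss_mean similarity_comp.
have nz := lt0r_neq0 pq0.
set u := (_ - _) / _; set v := - _ / _.
have -> : p * u - q * v = p by rewrite /u /v; field.
by have -> : p * v + q * u = - q by rewrite /u /v; field.
Qed.

Lemma nrm_cgauss_mean_adj phi : cbounded_measurable phi ->
  nrm (cgauss_mean s p (- q) phi) = nrm (cgauss_mean s p q phi).
Proof.
move=> bphi; rewrite cgauss_mean_similarity; apply: nrm_rotation.
  by have nz := lt0r_neq0 pq0; field.
exact/cbounded_inL2/cbounded_cgauss_mean.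
Qed.

(** This is normality. When both squares are expanded, the cross terms agree
by adjointness, and the terms |T^* phi|^2 and |T phi|^2 agree by rotation
invariance. *)
Lemma cgauss_mean_normal c phi : cbounded_measurable phi ->
  nrm (cgauss_mean s p (- q) phi \- (c^*%R \*o phi)) =
  nrm (cgauss_mean s p q phi \- (c \*o phi)).
Proof.
move=> bphi; have phi2 := cbounded_inL2 bphi.
have T2 r := cbounded_inL2 (cbounded_cgauss_mean r bphi).
have cphi2 a := inL2Z a phi2.
have sqE r a := sqr_nrmB (T2 r) (cphi2 a).
apply: (@pexpIrn _ 2) => //; rewrite ?nnegrE; [exact: nrm_ge0..|].
rewrite /= (sqE (- q) c^*%R) (sqE q c) (nrm_cgauss_mean_adj bphi).
rewrite (nrmZ c^*%R phi2) (nrmZ c phi2) normc_conj.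
rewrite (L2innerZr c^*%R phi2 (T2 (- q))) (L2innerZr c phi2 (T2 q)). rewrite conjCK.
rewrite (L2innerC phi2 (T2 (- q))) -(cgauss_mean_adjoint bphi bphi).
by case: c => a b; case: (dot _ _) => u v /=; ring.
Qed.

(** Move T - c to the other side, apply Cauchy-Schwarz, then normality. *)
Lemma cgauss_mean_weak_bound c phi psi :
  cbounded_measurable phi -> cbounded_measurable psi ->
  normc (dot (cgauss_mean s p q phi \- (c \*o phi)) psi) <=
  nrm phi * nrm (cgauss_mean s p q psi \- (c \*o psi)).
Proof.
move=> bphi bpsi; have phi2 := cbounded_inL2 bphi; have psi2 := cbounded_inL2 bpsi.
have Tphi2 := cbounded_inL2 (cbounded_cgauss_mean q bphi).
have Tpsi2 := cbounded_inL2 (cbounded_cgauss_mean (- q) bpsi).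
rewrite -cgauss_mean_normal//.
suff -> : dot (cgauss_mean s p q phi \- (c \*o phi)) psi =
    dot phi (cgauss_mean s p (- q) psi \- (c^*%R \*o psi)).
  by apply: cauchy_schwarz => //; apply: inL2B => //; exact: inL2Z.
rewrite L2innerBl ?L2innerBr//; try exact: inL2Z.
by rewrite L2innerZl// L2innerZr// conjCK cgauss_mean_adjoint.
Qed.

End normality.

(** * From the semigroup to its generator *)

Section ornstein_uhlenbeck_normality.
Context {R : realType}.
Implicit Types (t : R) (mu : R[i]) (f g u v w : R * R -> R[i]).

Local Notation B := (B_rot R).
Local Notation gamma := (OU_inv 1%:M B).
Local Notation dot := (L2inner gamma).
Local Notation nrm := (nrm gamma).

Lemma OU_inv_gauss : gamma = gauss (2^-1)%:M :> {measure set (plane R) -> \bar R}.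
Proof. by rewrite /OU_inv /OU_gauss OU_cov_infty. Qed.

Lemma OU_sg_gauss_mean t f : 0 < t ->
  OU_sg 1%:M B t f = cgauss_mean ((1 - expR (- (2 * t))) / 2) (expC t) (expS t) f.
Proof.
move=> t0; apply/funext => x.
by rewrite /OU_sg /OU_gauss OU_cov_fin// mxact_expmx.
Qed.

Lemma bounded_continuous_measurable f :
  bounded_continuous f -> cbounded_measurable f.
Proof.
move=> [cr ci [M fM]]; split; split; [exact: continuous_measurable_plane| |
  exact: continuous_measurable_plane|]; exists M => x; apply: le_trans (fM x).
  exact: normr_Re_le.
exact: normr_Im_le.
Qed.

Section fixed_time.
Variable t : R.
Hypothesis t0 : 0 < t.

Let s := (1 - expR (- (2 * t))) / 2.

Let s0 : 0 < s.
Proof.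
by rewrite divr_gt0// subr_gt0 -expR0 ltr_expR oppr_lt0 mulr_gt0.
Qed.

Let sE : 2 * s = 1 - (expC t ^+ 2 + expS t ^+ 2).
Proof. by rewrite expC2DexpS2 mulrC divfK. Qed.

Let pq0 : 0 < expC t ^+ 2 + expS t ^+ 2.
Proof. by rewrite expC2DexpS2 expR_gt0. Qed.

Lemma bounded_continuous_inL2 f : bounded_continuous f -> inL2 gamma f.
Proof.
move=> /bounded_continuous_measurable bf; rewrite OU_inv_gauss.
exact: cbounded_inL2.
Qed.

Lemma OU_sg_inL2 f : bounded_continuous f -> inL2 gamma (OU_sg 1%:M B t f).
Proof.
move=> /bounded_continuous_measurable bf; rewrite OU_inv_gauss OU_sg_gauss_mean//.
exact/cbounded_inL2/cbounded_cgauss_mean.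
Qed.

Lemma OU_sg_weak_bound mu f g : bounded_continuous f -> bounded_continuous g ->
  normc (dot (OU_sg 1%:M B t f \- (mu \*o f)) g) <=
  nrm f * nrm (OU_sg 1%:M B t g \- (mu \*o g)).
Proof.
move=> /bounded_continuous_measurable bf /bounded_continuous_measurable bg.
rewrite OU_inv_gauss !OU_sg_gauss_mean//.
exact: (cgauss_mean_weak_bound s0 sE pq0 mu bf bg).
Qed.

(** The inequality for the approximating sequences, up to errors tending
to 0. *)
Lemma OU_sgL2_weak_bound mu f F g G :
  OU_sgL2 1%:M B t f F -> OU_sgL2 1%:M B t g G ->
  normc (dot (F \- (mu \*o f)) g) <= nrm f * nrm (G \- (mu \*o g)).
Proof.
move=> [f2 F2 [phi [bphi phif TphiF]]] [g2 G2 [psi [bpsi psig TpsiG]]].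
pose T := OU_sg 1%:M B t.
have phi2 n := bounded_continuous_inL2 (bphi n).
have psi2 n := bounded_continuous_inL2 (bpsi n).
have Tphi2 n := OU_sg_inL2 (bphi n).
have Tpsi2 n := OU_sg_inL2 (bpsi n).
have {}phif : nrm (phi n \- f) @[n --> \oo] --> (0 : R).
  by apply: nrmB_cvg phif => //; exact: nearW.
have {}TphiF : nrm (T (phi n) \- F) @[n --> \oo] --> (0 : R).
  by apply: nrmB_cvg TphiF => //; exact: nearW.
have {}psig : nrm (psi n \- g) @[n --> \oo] --> (0 : R).
  by apply: nrmB_cvg psig => //; exact: nearW.
have {}TpsiG : nrm (T (psi n) \- G) @[n --> \oo] --> (0 : R).
  by apply: nrmB_cvg TpsiG => //; exact: nearW.
pose a n := nrm (T (phi n) \- F) + normc mu * nrm (phi n \- f).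
pose b n := nrm (T (psi n) \- G) + normc mu * nrm (psi n \- g).
have a0 : a n @[n --> \oo] --> (0 : R).
  rewrite [0 in X in _ --> X](_ : 0 = 0 + normc mu * 0); last by rewrite mulr0 addr0.
  exact: (cvgD TphiF (cvgMl_tmp (a := normc mu) phif)).
have b0 : b n @[n --> \oo] --> (0 : R).
  rewrite [0 in X in _ --> X](_ : 0 = 0 + normc mu * 0); last by rewrite mulr0 addr0.
  exact: (cvgD TpsiG (cvgMl_tmp (a := normc mu) psig)).
have combB h H k K : inL2 gamma h -> inL2 gamma H -> inL2 gamma k -> inL2 gamma K ->
    nrm ((K \- (mu \*o k)) \- (H \- (mu \*o h))) <=
    nrm (K \- H) + normc mu * nrm (k \- h).
  move=> h2 H2 k2 K2; have kh2 := inL2B k2 h2.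
  rewrite -[normc mu]normcN -(nrmZ (- mu) kh2).
  have := nrmD (inL2B K2 H2) (inL2Z (- mu) kh2); congr (nrm _ <= _).
  by apply/funext => x /=; ring.
have Fmu2 := inL2B F2 (inL2Z mu f2); have Gmu2 := inL2B G2 (inL2Z mu g2).
have triangle h k : inL2 gamma h -> inL2 gamma k -> nrm k <= nrm h + nrm (k \- h).
  move=> h2 k2; have := nrmD h2 (inL2B k2 h2); congr (nrm _ <= _).
  by apply/funext => x /=; rewrite addrC subrK.
apply: (cvgr_to_ge (F := nbhs \oo) (f := fun n => (nrm f + nrm (phi n \- f)) *
    (nrm (G \- (mu \*o g)) + b n) + a n * nrm g +
    (nrm (F \- (mu \*o f)) + a n) * nrm (psi n \- g))).
  rewrite [X in _ --> X](_ : _ = (nrm f + 0) * (nrm (G \- (mu \*o g)) + 0) +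
    0 * nrm g + (nrm (F \- (mu \*o f)) + 0) * 0); last by rewrite !addr0 mul0r mulr0 !addr0.
  apply: cvgD; last by apply: cvgM => //; apply: cvgD => //; exact: cvg_cst.
  apply: cvgD; last exact: (cvgMr_tmp (b := nrm g) a0).
  by apply: cvgM; apply: cvgD => //; exact: cvg_cst.
apply: nearW => n.
have Tphimu2 := inL2B (Tphi2 n) (inL2Z mu (phi2 n)).
have Tpsimu2 := inL2B (Tpsi2 n) (inL2Z mu (psi2 n)).
have an := combB _ _ _ _ f2 F2 (phi2 n) (Tphi2 n).
have bn := combB _ _ _ _ g2 G2 (psi2 n) (Tpsi2 n).
apply: le_trans (L2inner_perturb Fmu2 g2 Tphimu2 (psi2 n)) _.
apply: lerD; first apply: lerD.
- apply: le_trans (OU_sg_weak_bound mu (bphi n) (bpsi n)) _.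
  apply: ler_pM (triangle _ _ f2 (phi2 n)) _; try exact: nrm_ge0.
  by apply: le_trans (triangle _ _ Gmu2 Tpsimu2) _; rewrite lerD2l.
- by apply: ler_wpM2r => //; exact: nrm_ge0.
- by apply: ler_wpM2r; [exact: nrm_ge0|rewrite lerD2l].
Qed.

End fixed_time.

End ornstein_uhlenbeck_normality.

Section generator_normality.
Context {R : realType}.
Implicit Types (t : R) (mu nu : R[i]) (u v w : R * R -> R[i]).

Local Notation B := (B_rot R).
Local Notation gamma := (OU_inv 1%:M B).
Local Notation dot := (L2inner gamma).
Local Notation nrm := (nrm gamma).

(** The inequality of [OU_sgL2_weak_bound] with constant 1 + t mu, divided
by t, is the same inequality for the difference quotients; let t tend to 0. *)
Lemma OU_gen_weak_bound mu u u' w w' :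
  OU_gen 1%:M B u u' -> OU_gen 1%:M B w w' ->
  normc (dot (u' \- (mu \*o u)) w) <= nrm u * nrm (w' \- (mu \*o w)).
Proof.
move=> [u2 u'2 [h [hT hu']]] [w2 w'2 [k [kT kw']]].
pose A t := (t^-1)%:C \*o (h t \- u); pose D t := (t^-1)%:C \*o (k t \- w).
have A2 t : 0 < t -> inL2 gamma (A t).
  by move=> t0; have [_ ht2 _] := hT t t0; exact/inL2Z/inL2B.
have D2 t : 0 < t -> inL2 gamma (D t).
  by move=> t0; have [_ kt2 _] := kT t t0; exact/inL2Z/inL2B.
have mu2 f : inL2 gamma f -> inL2 gamma (mu \*o f) by exact: inL2Z.
have {}hu' : nrm (A t \- u') @[t --> 0^'+] --> (0 : R).
  by apply: nrmB_cvg hu' => //; near=> t; apply: A2.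
have {}kw' : nrm (D t \- w') @[t --> 0^'+] --> (0 : R).
  by apply: nrmB_cvg kw' => //; near=> t; apply: D2.
have quotient_bound t : 0 < t ->
    normc (dot (A t \- (mu \*o u)) w) <= nrm u * nrm (D t \- (mu \*o w)).
  move=> t0; have tC0 : t%:C != 0 :> R[i].
    by rewrite eq_complex /= eqxx andbT gt_eqF.
  have [_ ht2 _] := hT t t0; have [_ kt2 _] := kT t t0.
  (* H_t - (1 + t mu) is t times the difference quotient minus mu. *)
  have quotE f g : f \- ((1 + t%:C * mu) \*o g) =
      t%:C \*o (((t^-1)%:C \*o (f \- g)) \- (mu \*o g)).
    apply/funext => x /=; rewrite mulrBr mulrA -rmorphM/= divff ?gt_eqF//.
    by rewrite mul1r; ring.
  have := OU_sgL2_weak_bound t0 (1 + t%:C * mu) (hT t t0) (kT t t0).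
  rewrite !quotE (L2innerZl _ (inL2B (A2 _ t0) (mu2 _ u2)) w2).
  rewrite (nrmZ _ (inL2B (D2 _ t0) (mu2 _ w2))) normcM mulrCA.
  by rewrite ler_pM2l// /normc/= expr0n addr0 sqrtr_sqr gtr0_norm.
apply: (cvgr_to_ge (F := 0^'+) (f := fun t =>
    nrm u * (nrm (w' \- (mu \*o w)) + nrm (D t \- w')) + nrm (A t \- u') * nrm w)).
  rewrite [X in _ --> X](_ : _ = nrm u * (nrm (w' \- (mu \*o w)) + 0) + 0 * nrm w);
    last by rewrite mul0r !addr0.
  apply: cvgD; last exact: (cvgMr_tmp (b := nrm w) hu').
  apply: cvgMl_tmp; apply: cvgD => //; exact: cvg_cst.
near=> t; have t0 : 0 < t by [].
have Amu2 := inL2B (A2 _ t0) (mu2 _ u2).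
have Dmu2 := inL2B (D2 _ t0) (mu2 _ w2).
have triangle f g e : inL2 gamma f -> inL2 gamma g -> inL2 gamma e ->
    nrm (f \- e) <= nrm (g \- e) + nrm (f \- g).
  move=> f2 g2 e2; have := nrmD (inL2B g2 e2) (inL2B f2 g2).
  by congr (nrm _ <= _); apply/funext => x /=; ring.
have -> : dot (u' \- (mu \*o u)) w =
    dot (A t \- (mu \*o u)) w + - dot (A t \- u') w.
  by rewrite (L2innerBl (A2 _ t0) (mu2 _ u2) w2) (L2innerBl (A2 _ t0) u'2 w2)
             (L2innerBl u'2 (mu2 _ u2) w2); ring.
apply: le_trans (le_normcD _ _) _; rewrite normcN; apply: lerD.
  apply: le_trans (quotient_bound t t0) _; apply: ler_wpM2l; first exact: nrm_ge0.
  exact: triangle (D2 _ t0) w'2 (mu2 _ w2).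
exact: cauchy_schwarz (inL2B (A2 _ t0) u'2) w2.
Unshelve. all: by end_near. Qed.

Lemma OU_gen_pow1_nrm mu u : OU_gen_pow 1%:M B mu 1 u (fun=> 0) ->
  exists u', [/\ OU_gen 1%:M B u u', inL2 gamma (u' \- (mu \*o u)) &
    nrm (u' \- (mu \*o u)) = 0].
Proof.
move=> [u' [Luu' [u'2 u'0]]]; exists u'; split=> //.
exact/(nrm_eq0P u'2).
Qed.

(** If w = (L - mu) u satisfies (L - mu) w = 0, then [OU_gen_weak_bound] bounds
the square norm <(L - mu) u, w> of w by 0. *)
Lemma OU_gen_pow_collapse mu k u : OU_gen_pow 1%:M B mu k.+1 u (fun=> 0) ->
  OU_gen_pow 1%:M B mu 1 u (fun=> 0).
Proof.
elim: k u => [//|k IH] u [v [Luv /IH/OU_gen_pow1_nrm[w' [Lww' _ w'0]]]].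
exists v; split=> //; have w2 : inL2 gamma (v \- (mu \*o u)) by case: Lww'.
split=> //; apply/(nrm_eq0P w2)/eqP; rewrite -sqrf_eq0 eq_le sqr_ge0 andbT.
have := OU_gen_weak_bound mu Luv Lww'; rewrite w'0 mulr0; apply: le_trans.
by rewrite (L2inner_self w2) /normc/= expr0n addr0 sqrtr_sqr ler_norm.
Qed.

(** Apply [OU_gen_weak_bound] to the eigenvalue nu of v: the right-hand side
vanishes, and on the left L - nu multiplies u by mu - nu. *)
Lemma OU_eigenfunction_orthogonal mu nu u v :
  OU_gen_pow 1%:M B mu 1 u (fun=> 0) -> OU_gen_pow 1%:M B nu 1 v (fun=> 0) ->
  mu <> nu -> dot u v = 0.
Proof.
move=> /OU_gen_pow1_nrm[u' [Luu' du2 du0]] /OU_gen_pow1_nrm[v' [Lvv' dv2 dv0]].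
move=> /eqP munu; have [u2 u'2 _] := Luu'; have [v2 v'2 _] := Lvv'.
have /eq0_normc : normc (dot (u' \- (nu \*o u)) v) = 0.
  apply/eqP; rewrite eq_le normc_ge0 andbT.
  by have := OU_gen_weak_bound nu Luu' Lvv'; rewrite dv0 mulr0.
have -> : u' \- (nu \*o u) = (u' \- (mu \*o u)) \+ ((mu - nu) \*o u).
  by apply/funext => x /=; ring.
rewrite (L2innerDl du2 (inL2Z _ u2) v2) (L2innerZl _ u2 v2).
have -> : dot (u' \- (mu \*o u)) v = 0.
  apply: eq0_normc; apply/eqP; rewrite eq_le normc_ge0 andbT.
  by have := cauchy_schwarz du2 v2; rewrite du0 mul0r.
by move=> /eqP; rewrite add0r mulf_eq0 subr_eq0 (negbTE munu) => /eqP.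
Qed.

End generator_normality.

Theorem proposition4p1 (R : realType) :
  (forall (mu : R[i]) (u : R * R -> R[i]),
     OU_generalized_eigenfunction 1%:M (B_rot R) mu u ->
     OU_eigenfunction 1%:M (B_rot R) mu u) /\
  (forall (mu nu : R[i]) (u v : R * R -> R[i]),
     OU_eigenfunction 1%:M (B_rot R) mu u ->
     OU_eigenfunction 1%:M (B_rot R) nu v ->
     mu <> nu ->
     L2inner (OU_inv 1%:M (B_rot R)) u v = 0).
Proof.
split=> [mu u [u2 u0 [k [k0 Lku]]]|mu nu u v [_ _ Lu] [_ _ Lv]].
  by split=> //; apply: (@OU_gen_pow_collapse _ _ k.-1); rewrite prednK.
exact: OU_eigenfunction_orthogonal Lu Lv.
Qed.
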